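(* For every fixed $m\in\{0,1,2,\ldots\}$, as $n\to\infty$, $$\sup_{x\in\mathbb{R}}\big|F_{n,m}(x)-[F_m(x)+G_{n,m}(x)]\big|=O\!\left(\frac1n\right),$$ and there exist a constant $K_m>0$, a point $x_m\in\mathbb{R}$, a positive function $c_m(\cdot)$ and a threshold function $n_m(\cdot)$ with values in $\mathbb{N}$, all depending only on $m$, such that $$\sup_{x\in\mathbb{R}}|G_{n,m}(x)|\le K_m\frac{\log n}{n},\qquad n\ge m+2,$$ but $$|G_{n,m}(x)|\ge c_m(x)\frac{\log n}{n}\quad\text{for all } x\in(-\infty,x_m),\text{ whenever } n\ge n_m(x).$$ Furthermore, $$\sup_{x\in\mathbb{R}}\big|F^*_{n,m}(x)-[F^*_m(x)+G^*_{n,m}(x)]\big|=O\!\left(\frac1n\right),$$ where the sequence $G^*_{n,m}$ has the same properties: there exist a constant $K^*_m>0$, a point $x^*_m\in\mathbb{R}$, a positive function $c^*_m(\cdot)$ and a threshold function $n^*_m(\cdot)$ with values in $\mathbb{N}$, all depending only on $m$, such that $\sup_{x\in\mathbb{R}}|G^*_{n,m}(x)|\le K^*_m(\log n)/n$ for all $n\ge m+2$, and $|G^*_{n,m}(x)|\ge c^*_m(x)(\log n)/n$ for all $x\in(-\infty,x^*_m)$ whenever $n\ge n^*_m(x)$.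
   Context: Coupon collector's waiting time: for integers $n\ge2$ and $m\in\{0,\ldots,n-1\}$, coupons are drawn independently and uniformly at random with replacement from $n$ distinct coupons, and $W_{n,m}$ is the number of draws until $n-m$ distinct coupons have been collected for the first time. Equivalently, $W_{n,m}$ is distributed as a sum of independent random variables $X_{(m+1)/n},\ldots,X_{n/n}$ with $\mathbf P(X_{k/n}=j)=(1-\frac kn)^{j-1}\frac kn$, $j=1,2,\ldots$. Notation: - $F_{n,m}(x)=\mathbf P\big(\frac1nW_{n,m}-\sum_{k=m+1}^n\frac1k\le x\big)$, $x\in\mathbb{R}$. - $\gamma$ is Euler's constant and $C_m=\gamma-\sum_{k=1}^m\frac1k$. - $F_m(x)=\frac1{m!}\int_{-\infty}^{x}e^{-(m+1)(y+C_m)}e^{-e^{-(y+C_m)}}\,dy$, and $f_m=F_m'$, i.e. $f_m(x)=\frac1{m!}e^{-e^{-(x+C_m)}}e^{-(m+1)(x+C_m)}$. - For $k\in\mathbb{N}=\{1,2,\ldots\}$, $h_k(x)=ke^{-kx}$ for $x\ge0$ and $h_k(x)=0$ for $x<0$; $[f_m''\star h_k](x)=\int_0^\infty f_m''(x-y)h_k(y)\,dy$. - For $n\ge m+2$, $G_{n,m}(x)=-\frac1{2n}\sum_{k=m+1}^{n-1}\frac1k\int_{-\infty}^x[f_m''\star h_k](u)\,du$. - $F^*_{n,m}(x)=\mathbf P\big(\frac1nW_{n,m}-\log n\le x\big)$, $F_m^*(x)=\lim_{n\to\infty}F^*_{n,m}(x)=F_m(x-C_m)$, and for $n\ge m+2$,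 $G^*_{n,m}(x)=G_{n,m}\big(x-\big[\sum_{k=1}^n\frac1k-\log n\big]+\sum_{k=1}^m\frac1k\big)$. *)

(* Defs.v *)
(* MathComp-Analysis, over an arbitrary R : realType *)
From HB Require Import structures.
From mathcomp Require Import all_boot all_order all_algebra.
From mathcomp Require Import all_classical all_reals all_analysis.

Set Implicit Arguments.
Unset Strict Implicit.
Unset Printing Implicit Defensive.

Import Order.TTheory GRing.Theory Num.Theory.
Import numFieldNormedType.Exports.

Local Open Scope classical_set_scope.
Local Open Scope ring_scope.

Section CouponCollector.
Context d (T : measurableType d) (R : realType) (P : probability T R).

(* [X i] is the coupon obtained at draw number [i + 1].  Measurability of the
   singleton events suffices, since ['I_n] is finite. *)
Record coupon_draws (n : nat) (X : nat -> T -> 'I_n) : Prop := CouponDraws {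
  draws_measurable : forall i c, measurable (X i @^-1` [set c]);
  draws_uniform : forall i c, P (X i @^-1` [set c]) = (n%:R^-1)%:E;
  draws_independent : forall (s : seq nat) (A : nat -> set 'I_n), uniq s ->
    P (\bigcap_(i in [set` s]) (X i @^-1` A i)) =
    (\prod_(i <- s) P (X i @^-1` A i))%E }.

Definition distinct_coupons n (X : nat -> T -> 'I_n) (t : nat) (w : T) : nat :=
  #|codom (fun i : 'I_t => X i w)|.

(* W_{n,m}; the value is +oo on the null event where n - m distinct coupons
   are never collected. *)
Definition waiting_time n (X : nat -> T -> 'I_n) (m : nat) (w : T) : \bar R :=
  ereal_inf [set (t%:R)%:E | t in
    [set t | distinct_coupons X t w = (n - m)%N]].

Definition Fnm n (X : nat -> T -> 'I_n) (m : nat) (x : R) : R :=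
  fine (P [set w | ((n%:R^-1)%:E * waiting_time X m w
                    - (\sum_(m.+1 <= k < n.+1) k%:R^-1)%:E <= x%:E)%E]).

Definition Fnm_star n (X : nat -> T -> 'I_n) (m : nat) (x : R) : R :=
  fine (P [set w | ((n%:R^-1)%:E * waiting_time X m w
                    - (ln n%:R)%:E <= x%:E)%E]).

End CouponCollector.

Section Approximations.
Context (R : realType).
Notation mu := (@lebesgue_measure R).

Definition euler_gamma : R :=
  limn (fun n : nat => \sum_(1 <= k < n.+1) k%:R^-1 - ln n%:R : R).

Definition Cm (m : nat) : R := euler_gamma - \sum_(1 <= k < m.+1) k%:R^-1.

Definition Fm (m : nat) (x : R) : R :=
  (m`!%:R)^-1 * \int[mu]_(y in `]-oo, x])
    (expR (- (m.+1%:R * (y + Cm m))) * expR (- expR (- (y + Cm m)))).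

(* The derivative of [Fm m], in closed form. *)
Definition fm (m : nat) (x : R) : R :=
  (m`!%:R)^-1 * expR (- expR (- (x + Cm m))) *
  expR (- (m.+1%:R * (x + Cm m))).

Definition hk (k : nat) (x : R) : R :=
  if 0 <= x then k%:R * expR (- (k%:R * x)) else 0.

(* [f_m'' * h_k](x) *)
Definition fm2_conv_hk (m k : nat) (x : R) : R :=
  \int[mu]_(y in `[0, +oo[) (derive1n 2 (fm m) (x - y) * hk k y).

(* Only meaningful for n >= m + 2. *)
Definition Gnm (n m : nat) (x : R) : R :=
  - (2 * n%:R)^-1 * \sum_(m.+1 <= k < n)
    (k%:R^-1 * \int[mu]_(u in `]-oo, x]) fm2_conv_hk m k u).

(* The pointwise limit of [Fnm_star] as n tends to infinity, in closed form. *)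
Definition Fm_star (m : nat) (x : R) : R := Fm m (x - Cm m).

Definition Gnm_star (n m : nat) (x : R) : R :=
  Gnm n m (x - (\sum_(1 <= k < n.+1) k%:R^-1 - ln n%:R)
             + \sum_(1 <= k < m.+1) k%:R^-1).

(* Extended-real valued, so that no boundedness is presupposed. *)
Definition sup_norm (f : R -> R) : \bar R :=
  ereal_sup [set (`|f x|)%:E | x in [set: R]].

(* The two-sided log n / n control claimed for both correction sequences;
   [G] is quantified at fixed m, hence so are all the witnesses. *)
Definition log_order_correction (m : nat) (G : nat -> R -> R) : Prop :=
  exists (K xm : R) (c : R -> R) (N : R -> nat),
    [/\ 0 < K,
        forall x, 0 < c x,
        forall n, (m.+2 <= n)%N ->
          (sup_norm (G n) <= (K * (ln n%:R / n%:R))%:E)%E &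
        forall x, x < xm -> forall n, (N x <= n)%N ->
          c x * (ln n%:R / n%:R) <= `|G n x|].

End Approximations.

(* Main.v *)
(* The number of missing coupons after [t] draws is a Markov chain whose
   one-step operator is [1 + A / n], where [A g N = N (g (N - 1) - g N)]
   generates the semigroup of binomial thinnings.  Hence its [t]-step operator
   is [exp (t A / n) (1 - t A^2 / (2 n^2))] up to an error that the sup-norm
   contractivity of the chain makes [O (t / n^3 + t^2 / n^4)].  Applied to the
   indicator of [N <= m], [exp (t A / n)] gives a binomial distribution function,
   [A] acts on it as the derivative in [t / n], and the Poisson approximation of
   the binomial law turns the expansion into
   [H - (log n / (2 n)) H'' + O (1 / n)] uniformly, where [H (x + C_m) = F_m x].
   On the other side, convolving with [h_k] moves [f_m'] by [O (1 / k)], so that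
   [G_{n,m} = - (log n / (2 n)) f_m' + O (1 / n)] as well, and [f_m'] is positive
   to the left of [- log (m + 1) - C_m]. *)
Require Import Defs.
From HB Require Import structures.
From mathcomp Require Import all_boot all_order all_algebra.
From mathcomp Require Import all_classical all_reals all_analysis.
From mathcomp Require Import measurable_realfun ring lra.
Import Order.TTheory GRing.Theory Num.Theory.
Import numFieldNormedType.Exports.
Local Open Scope classical_set_scope.
Local Open Scope ring_scope.

Set Implicit Arguments.
Unset Strict Implicit.
Unset Printing Implicit Defensive.

(** * Families with [u_j' = u_{j+1} - j u_j] *)

(** The uniform bounds all have one source. Binomial and Poisson terms are factorials times
    probabilities, so the term of index j is at most j! whatever the parameters, and every
    derivative is a fixed finite combination of such terms. Multiplying a Poisson term by
    [exp (- z)] raises its index by one, so the same bound yields the decay at -oo and the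
    boundedness of [z H''(z)]. The latter turns the coefficient [t / (2 n^2)] into [log n / (2 n)],
    since [t / n = z + log n]. The accumulated chain error is [O (1 / n)] only while
    [(t / n)^2 <= n]; for later times the distribution function and its approximation are both
    within [O (1 / n)] of 1. In [G_{n,m}] the convolution errors [O (1 / k)] carry weights [1 / k],
    and the inverse squares are summable. As [f_m''] changes sign, Tonelli's theorem is applied to
    its nonnegative Poisson components. *)

Section OperatorCalculus.
Context (R : realType).
Implicit Types (u : nat -> R) (m n j k N : nat).

(* Both the binomial and the Poisson terms below, times [j`!], satisfy
   [u_j' = u_{j+1} - j u_j]: [fam_deriv k u j] is then the [k]-th derivative of [u_j],
   and [cdf_deriv m k u] that of the distribution function [\sum_(j <= m) u_j / j`!],
   whose first derivative telescopes to [u_{m+1} / m`!]. *)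
Fixpoint fam_deriv k u j : R :=
  if k is k'.+1 then fam_deriv k' u j.+1 - j%:R * fam_deriv k' u j else u j.

Definition cdf_deriv m k u : R :=
  if k is k'.+1 then (m`!%:R)^-1 * fam_deriv k' u m.+1
  else \sum_(j < m.+1) u j / j`!%:R.

Lemma fam_deriv0 k j : fam_deriv k (fun=> 0) j = 0.
Proof. by elim: k j => //= k IH j; rewrite !IH; ring. Qed.

Lemma cdf_deriv0 m k : cdf_deriv m k (fun=> 0) = 0.
Proof.
by case: k => [|k] /=; [rewrite big1// => i _; rewrite mul0r|rewrite fam_deriv0 mulr0].
Qed.

(** A derivative of order [k] combines finitely many entries with coefficients depending only on [k]
    and [j]. The profile [b] is arbitrary, so the same statement gives boundedness, decay and the
    Poisson error. *)
Lemma fam_deriv_dist (b : nat -> R) k j : exists2 C, 0 <= C & forall u v (e : R),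
  (forall j, `|u j - v j| <= b j * e) -> 0 <= e ->
  `|fam_deriv k u j - fam_deriv k v j| <= C * e.
Proof.
elim: k j => [|k IH] j /=.
  exists `|b j| => // u v e h e0; apply: (le_trans (h j)).
  by apply: ler_wpM2r => //; exact: ler_norm.
have [C1 C10 h1] := IH j.+1; have [C2 C20 h2] := IH j.
exists (C1 + j%:R * C2) => [|u v e h e0]; first by rewrite addr_ge0// mulr_ge0.
have := h1 u v e h e0; have := h2 u v e h e0.
set x := fam_deriv k u j; set y := fam_deriv k v j.
set x' := fam_deriv k u _; set y' := fam_deriv k v _.
move=> H2 H1.
have -> : x' - j%:R * x - (y' - j%:R * y) = (x' - y') - j%:R * (x - y) by ring.
apply: (le_trans (ler_normB _ _)); rewrite mulrDl lerD// normrM.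
by rewrite (ger0_norm (ler0n _ _)) -mulrA ler_wpM2l.
Qed.

Lemma cdf_deriv_dist (b : nat -> R) m k : exists2 C, 0 <= C & forall u v (e : R),
  (forall j, `|u j - v j| <= b j * e) -> 0 <= e ->
  `|cdf_deriv m k u - cdf_deriv m k v| <= C * e.
Proof.
case: k => [|k] /=.
  exists (\sum_(j < m.+1) `|b j|); first by apply: sumr_ge0.
  move=> u v e h e0; rewrite -sumrB mulr_suml.
  apply: (le_trans (ler_norm_sum _ _ _)); apply: ler_sum => i _.
  rewrite -mulrBl normrM normfV (ger0_norm (ler0n _ _)).
  apply: (@le_trans _ _ `|u i - v i|).
    by rewrite ler_piMr// invf_le1 ?ler1n ?ltr0n ?fact_gt0.
  by apply: (le_trans (h i)); apply: ler_wpM2r => //; exact: ler_norm.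
have [C C0 h] := fam_deriv_dist b k m.+1.
exists ((m`!%:R)^-1 * C) => [|u v e uv e0]; first by rewrite mulr_ge0.
rewrite -mulrBr normrM -mulrA ger0_norm ?invr_ge0//.
by rewrite ler_wpM2l ?invr_ge0// h.
Qed.

Lemma cdf_deriv_bound m k : exists2 C, 0 <= C & forall u,
  (forall j, `|u j| <= j`!%:R) -> `|cdf_deriv m k u| <= C.
Proof.
have [C C0 h] := cdf_deriv_dist (fun j => j`!%:R) m k; exists C => // u hu.
have := h u (fun=> 0) 1; rewrite mulr1 cdf_deriv0 subr0; apply => // j.
by rewrite subr0 mulr1.
Qed.

(* Used with [u] and [v] the binomial terms for [N] and [N - 1], and [c = N]. *)
Lemma fam_deriv_diff (c : R) u v :
  (forall j, c * (v j - u j) = u j.+1 - j%:R * u j) ->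
  forall k j, c * (fam_deriv k v j - fam_deriv k u j) = fam_deriv k.+1 u j.
Proof.
move=> h; elim=> [|k IH] j /=; first exact: h.
have E1 := IH j.+1; have E2 := IH j; rewrite /= in E1 E2.
rewrite -[in RHS]E1 -[X in _ = _ - j%:R * X]E2; ring.
Qed.

Lemma sum_telescope_fact m u :
  \sum_(j < m.+1) (u j.+1 - j%:R * u j) / j`!%:R = (m`!%:R)^-1 * u m.+1.
Proof.
elim: m => [|m IH]; first by rewrite big_ord1 /= fact0 mul0r subr0 invr1 mulr1 mul1r.
rewrite big_ord_recr /= IH factS natrM.
have : m`!%:R != 0 :> R by rewrite pnatr_eq0 -lt0n fact_gt0.
have : m.+1%:R != 0 :> R by rewrite pnatr_eq0.
move: (m.+1%:R) (m`!%:R) => a b a0 b0; field; exact/andP.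
Qed.

Lemma cdf_deriv_diff m (c : R) u v :
  (forall j, c * (v j - u j) = u j.+1 - j%:R * u j) ->
  forall k, c * (cdf_deriv m k v - cdf_deriv m k u) = cdf_deriv m k.+1 u.
Proof.
move=> h [|k] /=.
  rewrite -sumrB mulr_sumr -sum_telescope_fact; apply: eq_bigr => j _.
  by rewrite -h; ring.
have := fam_deriv_diff h k m.+1 => /= <-; ring.
Qed.

Lemma fam_deriv_derive (u : R -> nat -> R) (x : R) :
  (forall j, is_derive x 1 (fun y => u y j) (u x j.+1 - j%:R * u x j)) ->
  forall k j, is_derive x 1 (fun y => fam_deriv k (u y) j) (fam_deriv k.+1 (u x) j).
Proof.
move=> h; elim=> [|k IH] j; first exact: h.
have h1 := IH j.+1; have h2 := IH j.
have h3 := is_deriveZ (j%:R) h2.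
by have h4 := is_deriveB h1 h3.
Qed.

Lemma cdf_deriv_derive m (u : R -> nat -> R) (x : R) :
  (forall j, is_derive x 1 (fun y => u y j) (u x j.+1 - j%:R * u x j)) ->
  forall k, is_derive x 1 (fun y => cdf_deriv m k (u y)) (cdf_deriv m k.+1 (u x)).
Proof.
move=> h [|k].
  rewrite [X in is_derive _ _ _ X](_ : _ = \sum_(j < m.+1)
     (j`!%:R)^-1 *: (u x j.+1 - j%:R * u x j)); last first.
    by rewrite /= -sum_telescope_fact; apply: eq_bigr => j _; rewrite mulrC.
  rewrite [X in is_derive _ _ X](_ : _ = \sum_(j < m.+1)
     (j`!%:R)^-1 *: (fun y => u y j)); last first.
    apply/funext => y /=; rewrite fct_sumE; apply: eq_bigr => j _.
    by rewrite mulrC.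
  by apply: is_derive_sum => j; exact: is_deriveZ.
exact: (is_deriveZ _ (fam_deriv_derive h k m.+1)).
Qed.

End OperatorCalculus.

(** * Mean value and Taylor estimates *)

Section Calculus.
Context (R : realType).

Lemma mean_value_bound (f df : R -> R) (M a b : R) : a <= b ->
  (forall x, a <= x <= b -> is_derive x 1 f (df x)) ->
  (forall x, a <= x <= b -> `|df x| <= M) ->
  `|f b - f a| <= M * (b - a).
Proof.
move=> ab hd hM; have [||c] := @MVT_segment R f df a b ab.
- by move=> x; rewrite in_itv/= => /andP[? ?]; apply: hd; rewrite !ltW.
- apply: derivable_within_continuous => x; rewrite in_itv/= => h.
  by have [] := hd x h.
- rewrite in_itv/= => h ->; rewrite normrM (@ger0_norm _ (b - a)) ?subr_ge0//.
  by rewrite ler_wpM2r ?subr_ge0// hM.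
Qed.

Lemma lipschitz_derive_bound (f df : R -> R) (M a b : R) :
  (forall x : R, is_derive x 1 f (df x)) -> (forall x, `|df x| <= M) ->
  `|f a - f b| <= M * `|a - b|.
Proof.
move=> hd hM; wlog ba : a b / b <= a => [H|].
  have [/H//|/ltW/H] := leP b a.
  by rewrite distrC [`|a - b|]distrC.
by rewrite (@ger0_norm _ (a - b)) ?subr_ge0//; apply: (@mean_value_bound f df).
Qed.

(** Mean value bound for [f] minus its tangent at [a]. Only points to the right of [a] are involved,
    because the binomial terms in [q = exp (- x)] are controlled for [x >= 0]. *)
Lemma taylor_bound1 (f df d2f : R -> R) (M a d : R) : 0 <= d ->
  (forall x, a <= x -> is_derive x 1 f (df x)) ->
  (forall x, a <= x -> is_derive x 1 df (d2f x)) ->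
  (forall x, a <= x -> `|d2f x| <= M) ->
  `|f (a + d) - f a - d * df a| <= M * d ^+ 2.
Proof.
move=> d0 h1 h2 hM.
pose g (x : R) := f x - df a *: x.
have -> : f (a + d) - f a - d * df a = g (a + d) - g a.
  by rewrite /g /= /GRing.scale/=; ring.
apply: (le_trans (@mean_value_bound g (fun x => df x - df a) (M * d) _ _ _ _ _)).
- lra.
- move=> x /andP[ax _]; apply: is_deriveB; first exact: h1.
  have := @is_deriveZ R R R id (df a) x 1 1 (is_derive_id _ _).
  by rewrite /GRing.scale/= mulr1.
- move=> x /andP[ax xb].
  apply: (le_trans (@mean_value_bound df d2f M _ _ ax _ _)) => [y|y|].
  + by move=> /andP[? _]; apply: h2.
  + by move=> /andP[? _]; apply: hM.
  + rewrite ler_wpM2l//; last lra.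
    by apply: le_trans (hM a (lexx _)).
- by rewrite addrAC subrr add0r expr2 mulrA.
Qed.

Lemma taylor_bound2 (f df d2f d3f : R -> R) (M a d : R) : 0 <= d ->
  (forall x, a <= x -> is_derive x 1 f (df x)) ->
  (forall x, a <= x -> is_derive x 1 df (d2f x)) ->
  (forall x, a <= x -> is_derive x 1 d2f (d3f x)) ->
  (forall x, a <= x -> `|d3f x| <= M) ->
  `|f (a + d) - f a - d * df a - d ^+ 2 / 2 * d2f a| <= M * d ^+ 3.
Proof.
move=> d0 h1 h2 h3 hM.
have M0 : 0 <= M by apply: le_trans (hM a (lexx _)).
pose g (x : R) := f x - (d2f a / 2) *: (x - a) ^+ 2.
have dg x : a <= x -> is_derive x 1 g (df x - d2f a * (x - a)).
  move=> ax; apply: is_deriveB; first exact: h1.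
  have h : is_derive x 1 (fun x : R => x - a) (1 - 0).
    exact: is_deriveB.
  have := @is_deriveZ R R R _ (d2f a / 2) x 1 _ (is_deriveX 2 h).
  rewrite [X in is_derive _ _ _ X](_ : _ = d2f a * (x - a))//.
  by rewrite /GRing.scale/= subr0 expr1; field.
have -> : f (a + d) - f a - d * df a - d ^+ 2 / 2 * d2f a =
    g (a + d) - g a - d * df a.
  by rewrite /g /GRing.scale/=; field.
pose g2 (x : R) := g x - df a *: x.
have -> : g (a + d) - g a - d * df a = g2 (a + d) - g2 a.
  by rewrite /g2 /= /GRing.scale/=; ring.
apply: (le_trans (@mean_value_bound g2 (fun x => df x - d2f a * (x - a) - df a)
  (M * d ^+ 2) _ _ _ _ _)).
- lra.
- move=> x /andP[ax _]; apply: is_deriveB; first exact: dg.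
  have := @is_deriveZ R R R id (df a) x 1 1 (is_derive_id _ _).
  by rewrite /GRing.scale/= mulr1.
- move=> x /andP[ax xb].
  have := @taylor_bound1 df d2f d3f M a (x - a) _ h2 h3 hM.
  rewrite subrKC => /(_ _) H.
  have -> : df x - d2f a * (x - a) - df a = df x - df a - (x - a) * d2f a by ring.
  apply: le_trans (H _) _; first lra.
  rewrite ler_wpM2l// ler_pXn2r ?nnegrE//; lra.
- by rewrite addrAC subrr add0r -mulrA -exprSr.
Qed.

End Calculus.

(** * Binomial terms and the thinning semigroup *)

Section BinomialFamily.
Context (R : realType).
Implicit Types (m n j k N : nat) (q z tau : R).

(* [j`!] times the probability that a binomial variable with parameters
   [N] and [q] equals [j]. *)
Definition bterm q N j : R := (N ^_ j)%:R * q ^+ j * (1 - q) ^+ (N - j).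

Lemma btermS_diff q N j :
  N.+1%:R * (bterm q N j - bterm q N.+1 j)
  = bterm q N.+1 j.+1 - j%:R * bterm q N.+1 j.
Proof.
rewrite /bterm ffactSS natrM.
have [jN|] := leqP j N.
  have := ffactnSr N.+1 j; rewrite ffactSS => /(congr1 (fun k => k%:R : R)).
  rewrite !natrM natrB ?(leq_trans jN)// subSS subSn// exprS => E.
  rewrite [q ^+ j.+1]exprS E.
  move: (q ^+ j) ((1 - q) ^+ (N - j)) E => a b E.
  have -> : forall x y : R,
    N.+1%:R * ((N ^_ j)%:R * x * y - (N.+1 ^_ j)%:R * x * ((1 - q) * y)) =
    N.+1%:R * (N ^_ j)%:R * x * y - N.+1%:R * (N.+1 ^_ j)%:R * x * ((1 - q) * y).
    by move=> x y; ring.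
  rewrite E; ring.
move=> Nj; rewrite (ffact_small Nj).
have [Nj'|] := leqP j N.+1.
  have -> : j = N.+1 by apply/eqP; rewrite eqn_leq Nj' Nj.
  by rewrite !mulr0n mulr0 !mul0r !sub0r mulrN.
by move=> Nj'; rewrite (ffact_small Nj') !(mulr0n, mulr0, mul0r, subr0).
Qed.

(** The left side is the generator acting on [N]; the right side is that of [bterm_derive]. Hence
    the generator acts as the derivative in [x] when [q = exp (- x)]. *)
Lemma bterm_diff q N j :
  N%:R * (bterm q N.-1 j - bterm q N j) = bterm q N j.+1 - j%:R * bterm q N j.
Proof.
case: N => [|N]; last exact: btermS_diff.
by case: j => [|j]; rewrite /bterm !ffact0n /= !(mul0r, mulr0, subr0).
Qed.

Lemma bterm_bound q N j : 0 <= q <= 1 -> `|bterm q N j| <= j`!%:R.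
Proof.
move=> /andP[q0 q1].
have q1' : 0 <= 1 - q by rewrite subr_ge0.
rewrite ger0_norm; last by rewrite /bterm !mulr_ge0// exprn_ge0.
have [jN|Nj] := leqP j N; last by rewrite /bterm ffact_small// !mul0r.
have -> : bterm q N j = j`!%:R * ((1 - q) ^+ (N - j) * q ^+ j *+ 'C(N, j)).
  by rewrite /bterm -bin_ffact natrM -[_ *+ _]mulr_natr; ring.
rewrite ler_piMr//.
have := exprDn (1 - q) q N; rewrite subrK expr1n => E.
rewrite {2}E (bigD1 (Ordinal (jN : (j < N.+1)%N)))//= lerDl sumr_ge0// => i _.
by rewrite mulrn_wge0// mulr_ge0// exprn_ge0.
Qed.

Lemma is_derive_expRN (z : R) : is_derive z 1 (fun y : R => expR (- y)) (- expR (- z)).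
Proof.
have := @is_derive1_comp R expR -%R z _ _ (is_derive_expR (- z))
  (is_deriveN (is_derive_id z 1)).
by rewrite mulrN1; exact.
Qed.

Lemma bterm_derive N j (x : R) :
  is_derive x 1 (fun y => bterm (expR (- y)) N j)
   (bterm (expR (- x)) N j.+1 - j%:R * bterm (expR (- x)) N j).
Proof.
have hq := is_derive_expRN x.
set q := expR (- x) in hq *.
have h1 := is_deriveX j hq.
have h2 := is_deriveX (N - j) (is_deriveB (is_derive_cst (1 : R) x 1) hq).
have := is_deriveZ ((N ^_ j)%:R) (is_deriveM h1 h2).
rewrite [X in is_derive _ _ X _ -> _](_ : _ = (fun y => bterm (expR (- y)) N j)); last first.
  by apply/funext => y; rewrite /bterm !fctE /GRing.scale/= -mulrA.
rewrite [X in is_derive _ _ _ X -> _](_ : _ = (bterm q N j.+1 - j%:R * bterm q N j)) //.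
rewrite /GRing.scale /= !fctE /bterm -/q.
have [jN|Nj] := leqP j N; last first.
  by rewrite !ffact_small ?mul0r ?mulr0 ?subr0// ltnW.
rewrite ffactnSr natrM natrB//.
have E : j%:R * q ^+ j.-1 * - q = - (j%:R * q ^+ j).
  by case: (j) => [|i]; rewrite ?mul0r ?oppr0// mulrN -mulrA -exprSr.
rewrite E exprS subnS; ring.
Qed.

(** At time 0 thinning keeps every coupon and the binomial law is the point mass at [N]: this is the
    initial value of the chain. *)
Lemma bterm_at1 m N : cdf_deriv m 0 (bterm 1 N) = (N <= m)%N%:R.
Proof.
rewrite /cdf_deriv.
have h j : bterm 1 N j = (j == N)%:R * j`!%:R :> R.
  rewrite /bterm subrr expr1n mulr1; case: ltngtP => [jN|Nj|->].
  - by rewrite -subn_gt0 in jN; rewrite expr0n gtn_eqF// mulr0 mul0r.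
  - by rewrite ffact_small// !mul0r.
  - by rewrite subnn expr0 mulr1 mul1r ffactnn.
under eq_bigr => j _ do rewrite h mulfK ?pnatr_eq0 -?lt0n ?fact_gt0//.
have [Nm|mN] := leqP N m.
  rewrite (bigD1 (Ordinal (Nm : (N < m.+1)%N)))//= eqxx big1 ?addr0// => i.
  by rewrite -val_eqE /= => /negPf ->.
by rewrite big1// => i _; rewrite ltn_eqF// (leq_trans (ltn_ord i)).
Qed.


End BinomialFamily.

(** * The Markov chain of missing coupons *)

Section CollectorStep.
Context (R : realType).
Implicit Types (m n j k N t : nat) (g h : nat -> R).

(* One draw, acting on functions of the number of missing coupons. *)
Definition draw_step n g N : R :=
  (1 - N%:R / n%:R) * g N + N%:R / n%:R * g N.-1.

Definition at_most m N : R := (N <= m)%N%:R.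

(** For [N <= n] the two weights are nonnegative and sum to 1, so one draw is an average. *)
Lemma draw_step_contract n g h (e : R) : (0 < n)%N ->
  (forall N, (N <= n)%N -> `|g N - h N| <= e) ->
  forall N, (N <= n)%N -> `|draw_step n g N - draw_step n h N| <= e.
Proof.
move=> n0 gh N Nn; rewrite /draw_step.
have c0 : 0 <= N%:R / n%:R :> R by rewrite divr_ge0.
have c1 : N%:R / n%:R <= 1 :> R.
  by rewrite ler_pdivrMr ?ltr0n// mul1r ler_nat.
move: (N%:R / n%:R) c0 c1 => c c0 c1.
have h1 := gh N Nn; have h2 := gh N.-1 (leq_trans (leq_pred _) Nn).
have -> : (1 - c) * g N + c * g N.-1 - ((1 - c) * h N + c * h N.-1) =
  (1 - c) * (g N - h N) + c * (g N.-1 - h N.-1) by ring.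
apply: (le_trans (ler_normD _ _)); rewrite !normrM.
rewrite (ger0_norm c0) ger0_norm ?subr_ge0//.
have := ler_wpM2l c0 h2; have c1' : 0 <= 1 - c by rewrite subr_ge0.
have := ler_wpM2l c1' h1; lra.
Qed.

(* The lower bound is Markov's inequality for the number of missing coupons. *)
Lemma iter_draw_step_bounds m n t N : (0 < n)%N -> (N <= n)%N ->
  1 - N%:R * expR (- (t%:R / n%:R)) <= iter t (draw_step n) (at_most m) N <= 1.
Proof.
move=> n0 Nn.
have n0' : 0 < n%:R :> R by rewrite ltr0n.
(* The expected number of missing coupons after [t] draws is exactly [N (1 - 1/n)^t], which the
   induction can propagate; the exponential enters through [1 - 1/n <= exp (- 1/n)]. *)
suff : 1 - N%:R * (1 - n%:R^-1) ^+ t <= iter t (draw_step n) (at_most m) N <= 1.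
  case/andP => h1 h2; apply/andP; split => //; apply: le_trans h1.
  rewrite lerD2l lerN2 ler_wpM2l// -mulrN expRM_natl lerXn2r ?nnegrE ?expR_ge0//.
    by rewrite subr_ge0 invf_le1// ler1n.
  exact: expR_ge1Dx.
elim: t N Nn => [|t IH] N Nn.
  rewrite expr0 mulr1 /= /at_most; case: leqP => [_|mN]; rewrite ?lexx ?ler01 ?andbT.
    by rewrite gerBl.
  by rewrite subr_le0 ler1n (leq_ltn_trans _ mN).
have c0 : 0 <= N%:R / n%:R :> R by rewrite divr_ge0.
have c1 : N%:R / n%:R <= 1 :> R by rewrite ler_pdivrMr// mul1r ler_nat.
have /andP[h1 h2] := IH N Nn.
have /andP[h3 h4] := IH N.-1 (leq_trans (leq_pred _) Nn).
rewrite iterS {1 3}/draw_step.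
move: (iter t _ _ N) (iter t _ _ N.-1) h1 h2 h3 h4 => x y h1 h2 h3 h4.
set c := N%:R / n%:R in c0 c1 *; have c1' : 0 <= 1 - c by rewrite subr_ge0.
have E : c * N.-1%:R = c * (N%:R - 1).
  by rewrite /c; case: (N) => [|k]; rewrite ?mul0r// -natr1 addrK.
have := ler_wpM2l c0 h3; have := ler_wpM2l c0 h4.
have := ler_wpM2l c1' h1; have := ler_wpM2l c1' h2.
have -> : N%:R * (1 - n%:R^-1) ^+ t.+1 = (N%:R - c) * (1 - n%:R^-1) ^+ t.
  by rewrite exprS /c; ring.
move: ((1 - n%:R^-1) ^+ t) => a.
have -> : c * (1 - N.-1%:R * a) = c - c * (N%:R - 1) * a by rewrite -E; ring.
by move=> *; apply/andP; split; lra.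
Qed.

End CollectorStep.

(** * Second-order expansion of the iterated chain *)

Section CollectorExpansion.
Context (R : realType).
Implicit Types (m n j k N t : nat).

Lemma cdf_deriv_bterm_derive m k N (x : R) :
  is_derive x 1 (fun y => cdf_deriv m k (bterm (expR (- y)) N))
                (cdf_deriv m k.+1 (bterm (expR (- x)) N)).
Proof.
exact: (@cdf_deriv_derive _ m (fun y => bterm (expR (- y)) N) x
  (fun j => bterm_derive N j x) k).
Qed.

(* For the generator [A] of the thinning semigroup, [draw_step n] is
   [1 + A / n], so that its [t]-th power is
   [exp (t A / n) (1 - t A^2 / (2 n^2))] up to higher order. *)
Definition thinning_expansion m n t N : R :=
  cdf_deriv m 0 (bterm (expR (- (t%:R / n%:R))) N)
  - t%:R / (2 * n%:R ^+ 2) * cdf_deriv m 2 (bterm (expR (- (t%:R / n%:R))) N).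

Lemma draw_step_cdf_deriv m k n q N : (0 < n)%N ->
  draw_step n (fun N => cdf_deriv m k (bterm q N)) N
  = cdf_deriv m k (bterm q N) + n%:R^-1 * cdf_deriv m k.+1 (bterm q N) :> R.
Proof.
move=> n0; rewrite -(cdf_deriv_diff m (bterm_diff q N)) /draw_step; ring.
Qed.

(** With [d = 1/n], the Taylor term [d^2/2 f''] that one draw misses equals the increment of the
    correction from [t] to [t + 1], so order [d^2] cancels. There remain a third-order remainder,
    [d^3/2 f'''], and [(t + 1) d^2/2] times the second-order remainder of [f'']. *)
Lemma thinning_expansion_step m : exists2 C : R, 0 <= C &
  forall n t N, (0 < n)%N ->
  `|thinning_expansion m n t.+1 N - draw_step n (thinning_expansion m n t) N|
  <= C * (n%:R ^- 3 + t.+1%:R * n%:R ^- 4).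
Proof.
have [M3 M30 h3] := cdf_deriv_bound R m 3; have [M4 M40 h4] := cdf_deriv_bound R m 4.
exists (2 * M3 + M4) => [|n t N n0]; first lra.
have n0' : (n%:R : R) != 0 by rewrite pnatr_eq0 -lt0n.
set d : R := n%:R^-1.
have d0 : 0 <= d by rewrite invr_ge0.
set tau : R := t%:R * d.
have tau0 : 0 <= tau by rewrite mulr_ge0.
have tauS : t.+1%:R / n%:R = tau + d by rewrite -natr1 /tau -/d; ring.
pose f k (x : R) := cdf_deriv m k (bterm (expR (- x)) N).
have hb k M (hM : forall u : nat -> R, (forall j, `|u j| <= j`!%:R) -> `|cdf_deriv m k u| <= M) x :
    tau <= x -> `|f k x| <= M.
  move=> tx; apply: hM => j; apply: bterm_bound.
  by rewrite expR_ge0 expR_le1 oppr_le0 (le_trans tau0).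
have b3 := hb 3%N M3 h3; have b4 := hb 4%N M4 h4.
have E0 := @taylor_bound2 R (f 0%N) (f 1%N) (f 2%N) (f 3%N) M3 tau d d0
  (fun x _ => cdf_deriv_bterm_derive m 0 N x) (fun x _ => cdf_deriv_bterm_derive m 1 N x)
  (fun x _ => cdf_deriv_bterm_derive m 2 N x) b3.
have E2 := @taylor_bound1 R (f 2%N) (f 3%N) (f 4%N) M4 tau d d0
  (fun x _ => cdf_deriv_bterm_derive m 2 N x) (fun x _ => cdf_deriv_bterm_derive m 3 N x) b4.
have -> : thinning_expansion m n t.+1 N = f 0%N (tau + d) - t.+1%:R / 2 * d ^+ 2 * f 2%N (tau + d).
  rewrite /thinning_expansion tauS /f; congr (_ - _ * _).
  by rewrite /d invfM exprVn mulrA.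
have -> : draw_step n (thinning_expansion m n t) N =
   f 0%N tau + d * f 1%N tau - t%:R / 2 * d ^+ 2 * (f 2%N tau + d * f 3%N tau).
  rewrite -!(draw_step_cdf_deriv _ _ _ _ n0) /draw_step /thinning_expansion -/d -/tau.
  have -> : t%:R / (2 * n%:R ^+ 2) = t%:R / 2 * d ^+ 2 :> R.
    by rewrite /d invfM exprVn mulrA.
  ring.
have E3 := b3 tau (lexx _).
rewrite -!exprVn -/d.
set r0 := f 0%N (tau + d) - _ - _ - _ in E0.
set r2 := f 2%N (tau + d) - _ - _ in E2.
set s : R := t.+1%:R.
have s0 : 0 <= s by rewrite ler0n.
have -> : f 0%N (tau + d) - s / 2 * d ^+ 2 * f 2%N (tau + d) -
    (f 0%N tau + d * f 1%N tau - t%:R / 2 * d ^+ 2 * (f 2%N tau + d * f 3%N tau))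
  = r0 - d ^+ 3 / 2 * f 3%N tau - s / 2 * d ^+ 2 * r2.
  by rewrite /r0 /r2 /s -natr1; field.
have d3 : 0 <= d ^+ 3 by rewrite exprn_ge0.
have A1 : `|d ^+ 3 / 2 * f 3%N tau| <= d ^+ 3 / 2 * M3.
  by rewrite normrM ger0_norm ?ler_wpM2l// divr_ge0.
have A2 : `|s / 2 * d ^+ 2 * r2| <= s / 2 * d ^+ 2 * (M4 * d ^+ 2).
  have p : 0 <= s / 2 * d ^+ 2 by rewrite mulr_ge0 ?divr_ge0// exprn_ge0.
  by rewrite normrM ger0_norm ?ler_wpM2l.
apply: (le_trans (ler_normB _ _)); apply: (le_trans (lerD (ler_normB _ _) (lexx _))).
have q1 : 0 <= M4 * d ^+ 3 by rewrite mulr_ge0.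
have q2 : 0 <= M3 * d ^+ 3 by rewrite mulr_ge0.
have q3 : 0 <= M3 * (s * d ^+ 4) by rewrite !mulr_ge0// exprn_ge0.
have q4 : 0 <= M4 * (s * d ^+ 4) by rewrite !mulr_ge0// exprn_ge0.
have -> : (2 * M3 + M4) * (d ^+ 3 + s * d ^+ 4) = 2 * (M3 * d ^+ 3) + M4 * d ^+ 3 +
  2 * (M3 * (s * d ^+ 4)) + M4 * (s * d ^+ 4) by ring.
have A2' : s / 2 * d ^+ 2 * (M4 * d ^+ 2) = (M4 * (s * d ^+ 4)) / 2 by field.
rewrite A2' in A2.
have A1' : d ^+ 3 / 2 * M3 = (M3 * d ^+ 3) / 2 by ring.
rewrite A1' in A1.
lra.
Qed.

Lemma iter_draw_step_expansion m : exists2 C : R, 0 <= C &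
  forall n t N, (0 < n)%N -> (N <= n)%N ->
  `|iter t (draw_step n) (at_most R m) N - thinning_expansion m n t N|
  <= C * (t%:R * n%:R ^- 3 + t%:R ^+ 2 * n%:R ^- 4).
Proof.
have [C C0 hC] := thinning_expansion_step m; exists C => // n t N n0.
set d3 : R := n%:R ^- 3; set d4 : R := n%:R ^- 4.
elim: t N => [|t IH] N Nn.
  rewrite /thinning_expansion !mul0r oppr0 expR0 addr0 bterm_at1 subrr.
  by rewrite normr0 expr0n /= !mul0r addr0 mulr0.
rewrite iterS.
have h1 := draw_step_contract n0 IH Nn; have h2 := hC n t N n0.
apply: (le_trans (ler_distD (draw_step n (thinning_expansion m n t) N) _ _)).
rewrite distrC in h2; apply: (le_trans (lerD h1 h2)); rewrite -mulrDr.
apply: ler_wpM2l => //; rewrite -/d3 -/d4.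
have d40 : 0 <= d4 by rewrite invr_ge0 exprn_ge0.
rewrite -natr1.
have -> : (t%:R + 1) * d3 + (t%:R + 1) ^+ 2 * d4 =
   t%:R * d3 + t%:R ^+ 2 * d4 + (d3 + (t%:R + 1) * d4) + t%:R * d4 by ring.
by rewrite lerDl mulr_ge0.
Qed.

End CollectorExpansion.

(** * Poisson approximation *)

Section PoissonFamily.
Context (R : realType).
Implicit Types (m n j k N : nat) (q z : R).

(** The derivatives of the distribution function start at index [m.+1], so the entry 0 can be
    altered freely. This matters because [eterm z 0] tends to 1, not to 0, as [z] tends to +oo. *)
Lemma fam_deriv_ext k j (u v : nat -> R) : (forall i, (j <= i)%N -> u i = v i) ->
  fam_deriv k u j = fam_deriv k v j.
Proof.
elim: k j => [|k IH] j uv /=; first exact: uv.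
by rewrite !IH// => i ji; apply: uv => //; exact: ltnW.
Qed.

(* With [la = expR (- z)], [j`!] times the probability that a Poisson variable
   of mean [la] equals [j]; as functions of [z], [cdf_deriv m k (eterm z)] is the
   [k]-th derivative of the Gumbel-type distribution function [cdf_deriv m 0]. *)
Definition eterm z j : R := expR (- expR (- z)) * expR (- z) ^+ j.

Lemma eterm_derive j z :
  is_derive z 1 (fun y => eterm y j) (eterm z j.+1 - j%:R * eterm z j).
Proof.
have h := is_derive_expRN z.
have h1 := @is_derive1_comp R expR _ z _ _ (is_derive_expR (- expR (- z))) (is_deriveN h).
have := is_deriveM h1 (is_deriveX j h).
rewrite [X in is_derive _ _ _ X -> _](_ : _ = eterm z j.+1 - j%:R * eterm z j);
  first by rewrite !fctE; exact.
rewrite !fctE /GRing.scale /= /eterm.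
have E : j%:R * expR (- z) ^+ j.-1 * - expR (- z) = - (j%:R * expR (- z) ^+ j).
  by case: (j) => [|i]; rewrite ?mul0r ?oppr0// mulrN -mulrA -exprSr.
rewrite E exprS; ring.
Qed.

Lemma cdf_deriv_eterm_derive m k z :
  is_derive z 1 (fun y => cdf_deriv m k (eterm y)) (cdf_deriv m k.+1 (eterm z)).
Proof. exact: (cdf_deriv_derive m (fun j => eterm_derive j z) k). Qed.

Lemma expRN_exp_le (x : R) j : 0 <= x -> expR (- x) * x ^+ j <= j`!%:R.
Proof.
move=> x0; rewrite expRN mulrC ler_pdivrMr ?expR_gt0//.
case: j => [|j].
  by rewrite expr0 fact0 mul1r -expR0 ler_expR.
rewrite mulrC -ler_pdivrMr ?ltr0n ?fact_gt0//.
by apply: le_trans (expR_ge1Dxn j x0); rewrite lerDr.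
Qed.

Lemma eterm_ge0 z j : 0 <= eterm z j.
Proof. by rewrite mulr_ge0 ?exprn_ge0 ?expR_ge0. Qed.

Lemma eterm_le z j : eterm z j <= j`!%:R.
Proof. exact: (expRN_exp_le j (expR_ge0 _)). Qed.

Lemma etermS z j : eterm z j.+1 = expR (- z) * eterm z j.
Proof. by rewrite /eterm exprS; ring. Qed.

Lemma eterm_bound z j : `|eterm z j| <= j`!%:R.
Proof. by rewrite ger0_norm ?eterm_le// eterm_ge0. Qed.

Lemma cdf_deriv_eterm_bound m k : exists2 C : R, 0 <= C & forall z, `|cdf_deriv m k (eterm z)| <= C.
Proof.
have [C C0 h] := cdf_deriv_bound R m k; exists C => // z.
by apply: h => j; exact: eterm_bound.
Qed.

Lemma cdf_deriv_eterm_lipschitz m k : exists2 C : R, 0 <= C & forall x y,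
  `|cdf_deriv m k (eterm x) - cdf_deriv m k (eterm y)| <= C * `|x - y|.
Proof.
have [C C0 h] := cdf_deriv_eterm_bound m k.+1; exists C => // x y.
by apply: (lipschitz_derive_bound _ _ (fun z => cdf_deriv_eterm_derive m k z)).
Qed.

(** [eterm z j] is [exp (2 z)] times [eterm z j.+2], and the latter is at most [(j.+2)!]. *)
Lemma cdf_deriv_eterm_decay m k : exists2 C : R, 0 <= C & forall z,
  `|cdf_deriv m k (eterm z)| <= C * expR (2 * z).
Proof.
have [C C0 h] := cdf_deriv_dist (fun j => (j.+2)`!%:R : R) m k; exists C => // z.
rewrite -[cdf_deriv _ _ _]subr0 -(cdf_deriv0 R m k); apply: h => [j|]; last exact: expR_ge0.
rewrite subr0 ger0_norm ?eterm_ge0// expRM_natl.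
have := eterm_le z j.+2; rewrite !etermS => H.
have e : expR z * expR (- z) = 1 by rewrite expRxMexpNx_1.
have -> : eterm z j = (expR z * expR (- z)) ^+ 2 * eterm z j.
  by rewrite e expr1n mul1r.
rewrite exprMn -mulrA [leRHS]mulrC ler_wpM2l ?exprn_ge0 ?expR_ge0//.
by rewrite expr2 -mulrA.
Qed.

Lemma normr_le_expR z : `|z| <= expR z + expR (- z).
Proof.
have := expR_ge1Dx z; have := expR_ge1Dx (- z).
have := expR_ge0 z; have := expR_ge0 (- z).
case: (ger0P z); lra.
Qed.

(** [|z|] is at most [exp z + exp (- z)], and these factors shift the index by one down or up. The
    downward shift requires a positive index, so the entry 0 is replaced by zero. The bound is then
    applied with [e = 1 / |z|]. *)
Lemma cdf_deriv_eterm_moment m k : exists2 C : R, 0 <= C & forall z,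
  `|z * cdf_deriv m k.+1 (eterm z)| <= C.
Proof.
have [C C0 h] := cdf_deriv_dist (fun j => (j.-1)`!%:R + (j.+1)`!%:R : R) m k.+1.
exists C => // z.
have [->|z0] := eqVneq z 0; first by rewrite mul0r normr0.
pose u j := if j is 0 then 0 else eterm z j.
have -> : cdf_deriv m k.+1 (eterm z) = cdf_deriv m k.+1 u.
  by rewrite /=; congr (_ * _); apply: fam_deriv_ext => -[].
have z0' : 0 < `|z| by rewrite normr_gt0.
rewrite normrM mulrC -ler_pdivlMr//.
have := h u (fun=> 0) `|z|^-1; rewrite cdf_deriv0 subr0; apply; last by rewrite invr_ge0.
move=> j; rewrite subr0 ler_pdivlMr//.
case: j => [|j] /=; first by rewrite normr0 mul0r addr_ge0.
rewrite ger0_norm ?eterm_ge0//.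
apply: (@le_trans _ _ (eterm z j.+1 * (expR z + expR (- z)))).
  by rewrite ler_wpM2l ?eterm_ge0 ?normr_le_expR.
rewrite mulrDr lerD//.
  by rewrite etermS mulrC mulrA expRxMexpNx_1 mul1r eterm_le.
by rewrite mulrC -etermS eterm_le.
Qed.

Lemma cdf_deriv_eterm_at_infinity m : exists2 C : R, 0 <= C & forall z,
  `|cdf_deriv m 0 (eterm z) - 1| <= C * expR (- z) /\
  `|cdf_deriv m 2 (eterm z)| <= C * expR (- z).
Proof.
have [C C0 h] := cdf_deriv_dist (fun j => j`!%:R : R) m 0.
have [C' C'0 h'] := cdf_deriv_dist (fun j => j`!%:R : R) m 2.
exists (C + C') => [|z]; first exact: addr_ge0.
(* As [z] tends to +oo the Poisson mean [exp (- z)] vanishes, and the limiting family is the point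
   mass at 0. *)
pose v j : R := (j == 0)%N%:R.
have e0 : 0 <= expR (- z) by exact: expR_ge0.
have hv j : `|eterm z j - v j| <= j`!%:R * expR (- z).
  case: j => [|j].
    rewrite /v /= fact0 mul1r ler0_norm.
      rewrite opprB lerBlDl -lerBlDr /eterm expr0 mulr1.
      exact: expR_ge1Dx.
    by rewrite subr_le0 (le_trans (eterm_le _ _))// fact0.
  rewrite /v /= subr0 ger0_norm ?eterm_ge0// etermS mulrC ler_wpM2r//.
  by rewrite (le_trans (eterm_le _ _))// ler_nat factS leq_pmull.
have v0 : cdf_deriv m 0 v = 1.
  rewrite /= big_ord_recl /v /= fact0 divr1 big1 ?addr0// => i _.
  by rewrite mul0r.
have v2 : cdf_deriv m 2 v = 0.
  rewrite -(cdf_deriv0 R m 2) /cdf_deriv; congr (_ * _); apply: fam_deriv_ext => -[].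
split.
  rewrite -v0; apply: le_trans (h _ _ _ hv e0) _.
  by rewrite ler_wpM2r// lerDl.
rewrite -[cdf_deriv m 2 _]subr0 -v2; apply: le_trans (h' _ _ _ hv e0) _.
by rewrite ler_wpM2r// lerDr.
Qed.

Lemma ffact_ratio n j : (0 < n)%N -> (j <= n)%N ->
  1 - j%:R ^+ 2 / n%:R <= (n ^_ j)%:R / n%:R ^+ j :> R /\
  (n ^_ j)%:R / n%:R ^+ j <= 1 :> R.
Proof.
move=> n0; have n0' : 0 < n%:R :> R by rewrite ltr0n.
elim: j => [|j IH] jn; first by rewrite ffactn0 expr0 divr1 expr0n mul0r subr0.
have [h1 h2] := IH (ltnW jn).
rewrite ffactnSr natrM natrB ?(ltnW jn)// [n%:R ^+ j.+1]exprSr invfM.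
set a := (n ^_ j)%:R / _ in h1 h2.
have -> : (n ^_ j)%:R * (n%:R - j%:R) * (n%:R ^- j / n%:R) = a * (1 - j%:R / n%:R) :> R.
  rewrite /a; field; rewrite expf_neq0 ?lt0r_neq0//.
set b : R := j%:R / n%:R.
have b0 : 0 <= b by rewrite divr_ge0.
have b1 : b <= 1 by rewrite ler_pdivrMr// mul1r ler_nat ltnW.
have a0 : 0 <= a by rewrite divr_ge0// exprn_ge0.
rewrite -natr1.
have -> : (j%:R + 1) ^+ 2 / n%:R = j%:R ^+ 2 / n%:R + b + (b + n%:R^-1) :> R.
  by rewrite /b; ring.
have i0 : 0 <= n%:R^-1 :> R by rewrite invr_ge0.
have := ler_wpM2r b0 h2; have := mulr_ge0 a0 b0.
by split; lra.
Qed.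

(** Raise [1 - q^2 <= (1 - q) exp q] to the power [n] and bound the left side by Bernoulli's
    inequality. *)
Lemma binomial_zero_term n q : 0 <= q <= 1 ->
  expR (- (n%:R * q)) * (1 - n%:R * q ^+ 2) <= (1 - q) ^+ n.
Proof.
move=> /andP[q0 q1].
have s0 : 0 <= 1 - q ^+ 2 by rewrite subr_ge0 exprn_ile1.
have h : 1 - q ^+ 2 <= (1 - q) * expR q.
  have -> : 1 - q ^+ 2 = (1 - q) * (1 + q) by ring.
  by rewrite ler_wpM2l ?subr_ge0// expR_ge1Dx.
have b : 1 - n%:R * q ^+ 2 <= (1 - q ^+ 2) ^+ n.
  elim: n => [|n IH]; first by rewrite mul0r subr0 expr0.
  rewrite [leRHS]exprS; apply: le_trans (ler_wpM2l s0 IH).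
  rewrite -natr1 -subr_ge0.
  have -> : (1 - q ^+ 2) * (1 - n%:R * q ^+ 2) - (1 - (n%:R + 1) * q ^+ 2) = n%:R * q ^+ 4 by ring.
  by rewrite mulr_ge0// exprn_ge0.
rewrite mulrC expRN ler_pdivrMr ?expR_gt0// expRM_natl -exprMn.
by apply: (le_trans b); rewrite lerXn2r ?nnegrE// (le_trans s0 h).
Qed.

(** Uniformity in [q] comes from the exponential: with [la = n q], the relative errors are of order
    [la / n], [la^2 / n] and [j^2 / n], and [exp (- la) la^i <= i!] absorbs the powers of [la]. *)
Lemma binomial_Poisson j : exists2 C : R, 0 <= C & forall n q,
  (0 < n)%N -> 0 <= q <= 1 ->
  `|bterm q n j - expR (- (n%:R * q)) * (n%:R * q) ^+ j| <= C / n%:R.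
Proof.
(* Chosen so that [exp (j q) <= 1 + c q] on [[0, 1]]; this accounts for the exponent [n - j] instead
   of [n]. *)
pose c : R := j%:R * expR j%:R.
exists (c * (j.+1)`!%:R + (j.+2)`!%:R + j%:R ^+ 2 * j`!%:R + j%:R * j`!%:R).
  by rewrite !addr_ge0 ?mulr_ge0// ?expR_ge0 ?exprn_ge0.
move=> n q n0 /andP[q0 q1].
have n0' : 0 < n%:R :> R by rewrite ltr0n.
have n0'' : n%:R != 0 :> R by rewrite lt0r_neq0.
set la := n%:R * q.
have la0 : 0 <= la by rewrite mulr_ge0.
have f0 := expRN_exp_le j la0; have f1 := expRN_exp_le j.+1 la0.
have f2 := expRN_exp_le j.+2 la0.
set e := expR (- la) in f0 f1 f2 *; have e0 : 0 <= e by rewrite expR_ge0.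
have c0 : 0 <= c by rewrite mulr_ge0 ?expR_ge0.
have lj0 : 0 <= la ^+ j by rewrite exprn_ge0.
have p1 : 0 <= c * (j.+1)`!%:R by rewrite mulr_ge0.
have p2 : 0 <= j%:R ^+ 2 * j`!%:R :> R by rewrite mulr_ge0// exprn_ge0.
have p3 : 0 <= j%:R * j`!%:R :> R by rewrite mulr_ge0.
have p4 : 0 <= (j.+2)`!%:R :> R by [].
rewrite ler_pdivlMr//.
(* For [n < j] the binomial term vanishes and the Poisson term, at most [j!], is at most
   [j j! / n]. *)
have [jn|nj] := leqP j n; last first.
  rewrite /bterm ffact_small// !mul0r sub0r normrN ger0_norm ?mulr_ge0//.
  apply: (@le_trans _ _ (j%:R * j`!%:R)); last lra.
  by rewrite mulrC ler_pM ?mulr_ge0// ler_nat ltnW.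
have [a0 a1] := ffact_ratio n0 jn.
set a := (n ^_ j)%:R / _ in a0 a1.
set w := (1 - q) ^+ (n - j).
have -> : bterm q n j = a * la ^+ j * w.
  by rewrite /bterm -/w /a /la exprMn; field; rewrite expf_neq0.
have w1 : w - e <= e * (c * q).
  have h1 : w <= e * expR (j%:R * q).
    rewrite /w /e -expRD.
    have -> : - la + j%:R * q = (n - j)%:R * - q by rewrite natrB// /la; ring.
    rewrite expRM_natl lerXn2r ?nnegrE ?expR_ge0 ?subr_ge0//.
    exact: expR_ge1Dx.
  have h2 : expR (j%:R * q) <= 1 + c * q.
    set x := j%:R * q.
    have x0 : 0 <= x by rewrite mulr_ge0.
    have xj : x <= j%:R by rewrite ler_piMr.
    have : expR x * (1 - x) <= 1.
      by rewrite -[leRHS](expRxMexpNx_1 x) ler_wpM2l ?expR_ge0// expR_ge1Dx.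
    have : x * expR x <= c * q.
      by rewrite /c [leRHS]mulrAC -/x ler_wpM2l// ler_expR.
    by move=> *; lra.
  have := ler_wpM2l e0 h2; lra.
have w2 : - (e * (n%:R * q ^+ 2)) <= w - e.
  have h1 : (1 - q) ^+ n <= w.
    by rewrite /w ler_wiXn2l ?leq_subr// ?subr_ge0// lerBlDr lerDl.
  have /(binomial_zero_term n) : 0 <= q <= 1 by rewrite q0.
  rewrite -/la -/e; lra.
have W : `|w - e| * n%:R <= e * (c * la + la ^+ 2).
  have -> : e * (c * la + la ^+ 2) = (e * (c * q) + e * (n%:R * q ^+ 2)) * n%:R.
    by rewrite /la; ring.
  rewrite ler_wpM2r// ler_norml.
  have := mulr_ge0 e0 (mulr_ge0 c0 q0).
  have := mulr_ge0 e0 (mulr_ge0 (ltW n0') (exprn_ge0 2 q0)).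
  by move=> *; apply/andP; split; lra.
have a0' : 0 <= a by rewrite divr_ge0// exprn_ge0.
have -> : a * la ^+ j * w - e * la ^+ j = a * (la ^+ j * (w - e)) - (1 - a) * (e * la ^+ j) by ring.
have s1 : `|a * (la ^+ j * (w - e))| * n%:R <= c * (j.+1)`!%:R + (j.+2)`!%:R.
  rewrite normrM (ger0_norm a0') normrM (ger0_norm lj0).
  rewrite -[a * _ * _]mulrA -[la ^+ j * _ * _]mulrA.
  apply: (@le_trans _ _ (la ^+ j * (`|w - e| * n%:R))).
    by rewrite ler_piMl// !mulr_ge0.
  apply: (le_trans (ler_wpM2l lj0 W)).
  have -> : la ^+ j * (e * (c * la + la ^+ 2)) = c * (e * la ^+ j.+1) + e * la ^+ j.+2.
    by rewrite !exprS; ring.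
  by rewrite lerD// ler_wpM2l.
have s2 : `|(1 - a) * (e * la ^+ j)| * n%:R <= j%:R ^+ 2 * j`!%:R.
  rewrite normrM (ger0_norm (mulr_ge0 e0 lj0)) ger0_norm ?subr_ge0// mulrAC.
  rewrite ler_pM ?mulr_ge0 ?subr_ge0//.
  by rewrite -ler_pdivlMr//; lra.
apply: (le_trans (ler_wpM2r (ltW n0') (ler_normB _ _))).
rewrite [leLHS]mulrDl; lra.
Qed.

Lemma cdf_deriv_binomial_Poisson m k : exists2 C : R, 0 <= C & forall n tau,
  (0 < n)%N -> 0 <= tau ->
  `|cdf_deriv m k (bterm (expR (- tau)) n) - cdf_deriv m k (eterm (tau - ln n%:R))| <= C / n%:R.
Proof.
have [b hb] : exists b : nat -> R, forall j n q, (0 < n)%N -> 0 <= q <= 1 ->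
  `|bterm q n j - expR (- (n%:R * q)) * (n%:R * q) ^+ j| <= b j / n%:R.
  have /choice[b hb] : forall j, exists c : R, forall n q, (0 < n)%N -> 0 <= q <= 1 ->
    `|bterm q n j - expR (- (n%:R * q)) * (n%:R * q) ^+ j| <= c / n%:R.
    by move=> j; have [c _ hc] := binomial_Poisson j; exists c.
  by exists b => j n q; exact: hb.
have [C C0 h] := cdf_deriv_dist b m k; exists C => // n tau n0 tau0.
apply: h => [j|]; last by rewrite invr_ge0.
have n0' : (n%:R : R) \is Num.pos by rewrite posrE ltr0n.
rewrite /eterm.
have -> : expR (- (tau - ln n%:R)) = n%:R * expR (- tau).
  by rewrite opprB expRD lnK.
by apply: hb => //; rewrite expR_ge0 expR_le1 oppr_le0.
Qed.

End PoissonFamily.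

(** * Uniform second-order approximation of the distribution function *)

Section CollectorLimit.
Context (R : realType).
Implicit Types (m n t : nat) (y : R).

(** The probability of [W_{n,m} / n <= y], as [waiting_time_cdf] shows. Negative [y] has its own
    branch because [truncn] sends negative reals to 0. *)
Definition coupon_cdf n m y : R :=
  if y < 0 then 0
  else iter (Num.truncn (n%:R * y)) (draw_step n) (at_most R m) n.

Definition second_order n m (z : R) : R :=
  cdf_deriv m 0 (eterm z) - ln n%:R / (2 * n%:R) * cdf_deriv m 2 (eterm z).

Lemma log_ratio_bounds n : (0 < n)%N -> 0 <= (ln n%:R / (2 * n%:R) : R) <= 1.
Proof.
move=> n0; have n0' : 0 < n%:R :> R by rewrite ltr0n.
rewrite divr_ge0 ?ln_ge0 ?mulr_ge0 ?ler1n//=.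
rewrite ler_pdivrMr ?mulr_gt0// mul1r.
have := ln_sublinear n0'; lra.
Qed.

Lemma second_order_lipschitz m : exists2 C : R, 0 <= C & forall n x y,
  (0 < n)%N -> `|second_order n m x - second_order n m y| <= C * `|x - y|.
Proof.
have [C C0 h] := cdf_deriv_eterm_lipschitz R m 0; have [D D0 k] := cdf_deriv_eterm_lipschitz R m 2.
exists (C + D) => [|n x y n0]; first exact: addr_ge0.
have /andP[l0 l1] := log_ratio_bounds n0.
rewrite /second_order; set l := ln _ / _ in l0 l1 *.
have h1 := h x y; have h2 := k x y.
have -> : cdf_deriv m 0 (eterm x) - l * cdf_deriv m 2 (eterm x)
    - (cdf_deriv m 0 (eterm y) - l * cdf_deriv m 2 (eterm y))
  = cdf_deriv m 0 (eterm x) - cdf_deriv m 0 (eterm y)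
    - l * (cdf_deriv m 2 (eterm x) - cdf_deriv m 2 (eterm y)) by ring.
apply: (le_trans (ler_normB _ _)); rewrite mulrDl lerD// normrM (ger0_norm l0).
by apply: le_trans h2; rewrite ler_piMl.
Qed.

(** With [z = t/n - log n], the correction coefficient is [(z + log n) / (2 n)], and [z H''(z)] is
    bounded by [cdf_deriv_eterm_moment]. The time restriction keeps this coefficient below 1, so the
    Poisson error of the second derivative stays [O (1 / n)]. *)
Lemma thinning_expansion_limit m : exists2 C : R, 0 <= C & forall n t,
  (0 < n)%N -> (t%:R / n%:R) ^+ 2 <= n%:R :> R ->
  `|thinning_expansion R m n t n - second_order n m (t%:R / n%:R - ln n%:R)|
  <= C / n%:R.
Proof.
have [C0 C00 h0] := cdf_deriv_binomial_Poisson R m 0.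
have [C2 C20 h2] := cdf_deriv_binomial_Poisson R m 2.
have [D D0 k] := cdf_deriv_eterm_moment R m 1.
exists (C0 + C2 + D) => [|n t n0]; first lra.
have n0' : 0 < n%:R :> R by rewrite ltr0n.
have n1 : 1 <= n%:R :> R by rewrite ler1n.
rewrite /thinning_expansion /second_order.
have -> : t%:R / (2 * n%:R ^+ 2) = (t%:R / n%:R) / (2 * n%:R) :> R.
  by field; rewrite lt0r_neq0.
have : 0 <= t%:R / n%:R :> R by rewrite divr_ge0.
move: (t%:R / n%:R) => tau tau0 taun.
have taun' : tau <= n%:R.
  rewrite leNgt; apply/negP => ntau.
  have : n%:R * n%:R < tau * tau by rewrite ltr_pM ?ler0n.
  have : 1 * n%:R <= n%:R * n%:R :> R by rewrite ler_wpM2r.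
  rewrite expr2 in taun; lra.
have := h0 n tau n0 tau0; have := h2 n tau n0 tau0; have := k (tau - ln n%:R).
set z := tau - ln n%:R.
have -> : tau = z + ln n%:R by rewrite /z; ring.
rewrite -/z.
have -> : z + ln n%:R = tau by rewrite /z; ring.
set b0 := cdf_deriv m 0 (bterm _ _); set b2 := cdf_deriv m 2 (bterm _ _).
set e0 := cdf_deriv m 0 (eterm _); set e2 := cdf_deriv m 2 (eterm _) => K H2 H0.
have c0 : 0 <= tau / (2 * n%:R) by rewrite divr_ge0// mulr_ge0.
have c1 : tau / (2 * n%:R) <= 1 by rewrite ler_pdivrMr ?mulr_gt0//; lra.
have -> : b0 - tau / (2 * n%:R) * b2 - (e0 - ln n%:R / (2 * n%:R) * e2) =
  (b0 - e0) - tau / (2 * n%:R) * (b2 - e2) - (z * e2) * (2 * n%:R)^-1.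
  by rewrite /z; field; rewrite lt0r_neq0.
apply: (le_trans (ler_normB _ _)); rewrite [leRHS]mulrDl lerD//; last first.
  rewrite normrM (@ger0_norm _ (_^-1)) ?invr_ge0 ?mulr_ge0//.
  have i : (2 * n%:R)^-1 <= n%:R^-1 :> R by rewrite lef_pV2 ?posrE ?mulr_gt0//; lra.
  by apply: ler_pM => //; rewrite invr_ge0 mulr_ge0.
apply: (le_trans (ler_normB _ _)); rewrite [leRHS]mulrDl lerD//.
by rewrite normrM ger0_norm//; apply: le_trans H2; rewrite ler_piMl.
Qed.

Lemma second_order_left_tail m : exists2 C : R, 0 <= C & forall n y,
  (0 < n)%N -> y < 0 -> `|second_order n m (y - ln n%:R)| <= C / n%:R.
Proof.
have [C C0 h] := cdf_deriv_eterm_decay R m 0; have [D D0 k] := cdf_deriv_eterm_decay R m 2.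
exists (C + D) => [|n y n0 y0]; first exact: addr_ge0.
have n0' : 0 < n%:R :> R by rewrite ltr0n.
have n1 : 1 <= n%:R :> R by rewrite ler1n.
have /andP[l0 l1] := log_ratio_bounds n0.
have E : expR (2 * (y - ln n%:R)) <= n%:R^-1.
  apply: (@le_trans _ _ (expR (- ln n%:R))); last by rewrite expRN lnK// posrE.
  by rewrite ler_expR; have := @ln_ge0 R n%:R n1; lra.
have E0 : 0 <= expR (2 * (y - ln n%:R)) by exact: expR_ge0.
rewrite /second_order; set l := ln _ / _ in l0 l1 *.
apply: (le_trans (ler_normB _ _)); rewrite [leRHS]mulrDl lerD//.
  by apply: (le_trans (h _)); rewrite ler_wpM2l.
rewrite normrM (ger0_norm l0).
apply: (@le_trans _ _ `|cdf_deriv m 2 (eterm (y - ln n%:R))|); first by rewrite ler_piMl.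
by apply: (le_trans (k _)); rewrite ler_wpM2l.
Qed.

(** Covers the times beyond the range of the expansion. The second bound is the Markov term of
    [iter_draw_step_bounds] for [N = n]. *)
Lemma second_order_right_tail m : exists2 C : R, 0 <= C & forall n tau y,
  (0 < n)%N -> 0 <= tau -> n%:R < tau ^+ 2 -> tau <= y ->
  `|1 - second_order n m (y - ln n%:R)| <= C / n%:R /\
  n%:R * expR (- tau) <= C / n%:R.
Proof.
have [C C0 h] := cdf_deriv_eterm_at_infinity R m.
(* [24 = 4!] bounds [exp (- tau) tau^4], and [tau^4 > n^2]; [48 C] adds the tails of [H] and of
   [H'']. *)
exists (48 * C + 24) => [|n tau y n0 tau0 ntau tauy]; first lra.
have n0' : 0 < n%:R :> R by rewrite ltr0n.
have n1 : 1 <= n%:R :> R by rewrite ler1n.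
have /andP[l0 l1] := log_ratio_bounds n0.
have T : n%:R * expR (- tau) <= 24 / n%:R.
  have := expRN_exp_le 4 tau0.
  have -> : 4`! = 24%N by [].
  have := expR_ge0 (- tau); set e := expR (- tau) => e0 H.
  rewrite ler_pdivlMr// mulrC mulrA.
  have : n%:R * n%:R * e <= tau ^+ 2 * tau ^+ 2 * e.
    by rewrite ler_wpM2r// ler_pM// ltW.
  have -> : tau ^+ 2 * tau ^+ 2 * e = e * tau ^+ 4 by ring.
  lra.
have i0 : 0 <= n%:R^-1 :> R by rewrite invr_ge0 ltW.
have c0 := mulr_ge0 C0 i0.
split; last by apply: (le_trans T); rewrite ler_wpM2r//; lra.
have [h1 h2] := h (y - ln n%:R).
have E : expR (- (y - ln n%:R)) <= 24 / n%:R.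
  rewrite opprB expRD lnK ?posrE//; apply: le_trans T.
  by rewrite (ler_wpM2l (ltW n0'))// ler_expR lerN2.
have E' := ler_wpM2l C0 E.
rewrite /second_order; set l := ln _ / _ in l0 l1 *.
rewrite distrC in h1.
have -> : forall a b : R, 1 - (a - b) = 1 - a + b by move=> a b; ring.
apply: (le_trans (ler_normD _ _)).
have : `|l * cdf_deriv m 2 (eterm (y - ln n%:R))| <= `|cdf_deriv m 2 (eterm (y - ln n%:R))|.
  by rewrite normrM (ger0_norm l0) ler_piMl.
have -> : (48 * C + 24) / n%:R = 48 * (C / n%:R) + 24 / n%:R by ring.
have : C * (24 / n%:R) = 24 * (C / n%:R) by ring.
have : 0 <= 24 / n%:R :> R by rewrite mulr_ge0.
lra.
Qed.

(** With [tau = t/n] the chain error is [(tau + tau^2) / n^2], which is [O (1 / n)] when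
    [tau^2 <= n]; the tail bounds settle the other cases. Rounding [n y] down to [t] moves the
    argument by at most [1/n], a Lipschitz error. *)
Theorem coupon_cdf_second_order m : exists2 C : R, 0 <= C & forall n y,
  (0 < n)%N ->
  `|coupon_cdf n m y - second_order n m (y - ln n%:R)| <= C / n%:R.
Proof.
have [C1 C10 h1] := second_order_left_tail m.
have [C2 C20 h2] := second_order_right_tail m.
have [C3 C30 h3] := thinning_expansion_limit m.
have [C4 C40 h4] := second_order_lipschitz m.
have [C5 C50 h5] := iter_draw_step_expansion R m.
exists (C1 + 2 * C2 + C3 + C4 + 3 * C5) => [|n y n0]; first lra.
have n0' : 0 < n%:R :> R by rewrite ltr0n.
have n1 : 1 <= n%:R :> R by rewrite ler1n.
set d : R := n%:R^-1.
have d0 : 0 <= d by rewrite invr_ge0 ltW.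
have p1 := mulr_ge0 C10 d0; have p2 := mulr_ge0 C20 d0.
have p3 := mulr_ge0 C30 d0; have p4 := mulr_ge0 C40 d0.
have p5 := mulr_ge0 C50 d0.
have -> : (C1 + 2 * C2 + C3 + C4 + 3 * C5) * d =
  C1 * d + 2 * (C2 * d) + C3 * d + C4 * d + 3 * (C5 * d) by ring.
rewrite /coupon_cdf; case: ltP => y0.
  by rewrite sub0r normrN; have := h1 n y n0 y0; rewrite -/d; lra.
set t := Num.truncn (n%:R * y).
have /andP[t1 t2] : t%:R <= n%:R * y < t.+1%:R by apply: truncn_itv; rewrite mulr_ge0.
set tau : R := t%:R * d.
have tau0 : 0 <= tau by rewrite mulr_ge0.
have tauy : tau <= y by rewrite /tau ler_pdivrMr// mulrC.
have tauy' : y - tau <= d.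
  have : y <= t.+1%:R * d by rewrite ler_pdivlMr// mulrC ltW.
  by rewrite -natr1 mulrDl mul1r -/tau; lra.
have [taun|ntau] := leP (tau ^+ 2) n%:R; last first.
  have [H1 H2] := h2 n tau y n0 tau0 ntau tauy.
  have /andP[] := iter_draw_step_bounds R m t n0 (leqnn n).
  rewrite -/d -/tau in H1 H2 *; move: (iter _ _ _ _) => F F1 F2.
  have : `|F - 1| <= C2 * d by rewrite ler_norml; apply/andP; split; lra.
  have := ler_distD 1 F (second_order n m (y - ln n%:R)); lra.
have H5 := h5 n t n n0 (leqnn n).
have H3 := h3 n t n0 taun.
have H4 := h4 n (tau - ln n%:R) (y - ln n%:R) n0.
have E4 : `|tau - ln n%:R - (y - ln n%:R)| <= d.
  have -> : tau - ln n%:R - (y - ln n%:R) = tau - y by ring.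
  by rewrite ler0_norm; lra.
have E5 : t%:R * n%:R ^- 3 + t%:R ^+ 2 * n%:R ^- 4 <= 3 * d.
  have -> : t%:R * n%:R ^- 3 + t%:R ^+ 2 * n%:R ^- 4 = (tau + tau ^+ 2) * d ^+ 2 :> R.
    by rewrite /tau /d; field; rewrite lt0r_neq0.
  have -> : 3 * d = 3 * n%:R * d ^+ 2 by rewrite /d; field; rewrite lt0r_neq0.
  rewrite ler_wpM2r ?exprn_ge0//.
  have := sqr_ge0 (tau - 1); rewrite sqrrB1; lra.
have E4' := ler_wpM2l C40 E4; have E5' := ler_wpM2l C50 E5.
rewrite -/d -/tau in H3.
have := ler_distD (thinning_expansion R m n t n) (iter t (draw_step n) (at_most R m) n)
  (second_order n m (y - ln n%:R)).
have := ler_distD (second_order n m (tau - ln n%:R)) (thinning_expansion R m n t n)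
  (second_order n m (y - ln n%:R)).
lra.
Qed.

End CollectorLimit.

(** * The law of the waiting time *)

Section WaitingTime.
Context d (T : measurableType d) (R : realType) (P : probability T R).
Context (n m : nat) (X : nat -> T -> 'I_n) (hX : coupon_draws P X).
Context (n0 : (0 < n)%N).

Let draws (t : nat) (w : T) : seq 'I_n := mkseq (fun i => X i w) t.

Lemma distinct_couponsE t w : distinct_coupons X t w = #|draws t w|.
Proof.
apply: eq_card => x; rewrite /draws /mkseq; apply/idP/idP.
  by move=> /codomP[i ->]; apply/mapP; exists (val i) => //; rewrite mem_iota/= add0n.
move=> /mapP[i]; rewrite mem_iota /= add0n => it ->.
by apply/codomP; exists (Ordinal it).
Qed.

Lemma card_rcons (c : seq 'I_n) x : #|rcons c x| = ((x \notin c) + #|c|)%N.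
Proof. by rewrite -cardU1; apply: eq_card => y; rewrite mem_rcons. Qed.

Lemma drawsS t w : draws t.+1 w = rcons (draws t w) (X t w).
Proof. by rewrite /draws /mkseq -addn1 iotaD map_cat cats1. Qed.

Lemma distinct_couponsS t w :
  (distinct_coupons X t w <= distinct_coupons X t.+1 w <= (distinct_coupons X t w).+1)%N.
Proof.
rewrite !distinct_couponsE drawsS card_rcons leq_addl /=.
by rewrite -add1n leq_add2r leq_b1.
Qed.

Lemma distinct_coupons0 w : distinct_coupons X 0 w = 0%N.
Proof. by rewrite distinct_couponsE card0. Qed.

(** The count starts at 0 and grows by at most one per draw, so it skips no level. This reconciles
    the equality in [waiting_time] with an inequality at one fixed time. *)
Lemma distinct_coupons_reached K t w :
  (exists2 s, distinct_coupons X s w = K & (s <= t)%N) <->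
  (K <= distinct_coupons X t w)%N.
Proof.
split=> [[s <-]|].
  elim: t => [|t IH]; first by rewrite leqn0 => /eqP ->.
  rewrite leq_eqVlt => /predU1P[->//|/IH h].
  by apply: (leq_trans h); have /andP[] := distinct_couponsS t w.
elim: t => [|t IH].
  by rewrite distinct_coupons0 leqn0 => /eqP ->; exists 0%N; rewrite ?distinct_coupons0.
have [/IH[s sK st] _|Kt] := leqP K (distinct_coupons X t w).
  by exists s => //; exact: leqW.
move=> KS; exists t.+1 => //; apply/eqP; rewrite eqn_leq KS andbT.
by have /andP[_ h] := distinct_couponsS t w; exact: leq_trans h Kt.
Qed.

Lemma waiting_time_le w (S x : R) :
  ((n%:R^-1)%:E * waiting_time R X m w - S%:E <= x%:E)%E <->
  exists2 s, distinct_coupons X s w = (n - m)%N & s%:R <= n%:R * (x + S).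
Proof.
have n0' : 0 < n%:R :> R by rewrite ltr0n.
rewrite /waiting_time; set A := [set t | _].
have [A0|/set0P[s0 As0]] := eqVneq A set0.
  rewrite A0 image_set0 ereal_inf0 gt0_muley ?lte_fin ?invr_gt0//.
  by split=> // -[s sK]; have : A s by []; rewrite A0.
have hex : exists s, distinct_coupons X s w == (n - m)%N by exists s0; apply/eqP.
have [s1 /eqP As1 mins1] := ex_minnP hex.
have -> : ereal_inf [set (t%:R)%:E | t in A] = (s1%:R : R)%:E.
  apply/eqP; rewrite eq_le; apply/andP; split.
    by apply: ereal_inf_lbound; exists s1.
  by apply: le_ereal_inf_tmp => _ [s /= /eqP /mins1 As <-]; rewrite lee_fin ler_nat.
rewrite -EFinM -EFinB lee_fin lerBlDr ler_pdivrMl//.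
split=> [h|[s /eqP /mins1 s1s h]]; first by exists s1.
by apply: le_trans h; rewrite ler_nat.
Qed.

Lemma waiting_time_le_distinct w (S x : R) :
  ((n%:R^-1)%:E * waiting_time R X m w - S%:E <= x%:E)%E <->
  0 <= x + S /\
  (n - m <= distinct_coupons X (Num.truncn (n%:R * (x + S))) w)%N.
Proof.
have n0' : 0 < n%:R :> R by rewrite ltr0n.
rewrite waiting_time_le -distinct_coupons_reached; split.
  move=> [s sK h]; have y0 : 0 <= x + S.
    by rewrite -(pmulr_rge0 _ n0') (le_trans _ h).
  by split => //; exists s => //; rewrite truncn_ge_nat// mulr_ge0// ltW.
move=> [y0 [s sK h]]; exists s => //.
by move: h; rewrite truncn_ge_nat// mulr_ge0// ltW.
Qed.

Let cylinder (c : seq 'I_n) : set T := [set w | draws (size c) w = c].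

Lemma prode_cst (I : Type) (s : seq I) (a : R) :
  (\prod_(i <- s) a%:E)%E = (a ^+ size s)%:E.
Proof.
by elim: s => [|i s IH]; rewrite ?big_nil ?big_cons ?IH//= exprS EFinM.
Qed.

Lemma cylinderE c : cylinder c =
  \bigcap_(i in [set` iota 0 (size c)]) (X i @^-1` [set nth (Ordinal n0) c i]).
Proof.
apply/seteqP; split => w /=.
  move=> E i /=; rewrite mem_iota /= add0n => ic.
  by rewrite -E nth_mkseq.
move=> h; apply: (@eq_from_nth _ (Ordinal n0)); first by rewrite size_mkseq.
move=> i; rewrite size_mkseq => ic; rewrite nth_mkseq//.
by apply: h; rewrite /= mem_iota.
Qed.

Lemma cylinder_measurable c : measurable (cylinder c).
Proof.
rewrite cylinderE; apply: fin_bigcap_measurable => // i _.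
exact: (draws_measurable hX).
Qed.

Lemma cylinder_prob c : P (cylinder c) = ((n%:R^-1) ^+ size c)%:E.
Proof.
rewrite cylinderE (draws_independent hX) ?iota_uniq//.
under eq_bigr => i _ do rewrite (draws_uniform hX).
by rewrite prode_cst size_iota.
Qed.

Let reached (t : nat) : set T := [set w | (n - m <= #|draws t w|)%N].

Lemma cylinder_split c (E : set T) :
  cylinder c `&` E = \big[setU/set0]_(x < n) (cylinder (rcons c x) `&` E).
Proof.
rewrite -bigcup_seq; apply/seteqP; split => w.
  move=> [cw Ew]; exists (X (size c) w); rewrite /= ?mem_index_enum//; split => //.
  by rewrite /cylinder /= size_rcons drawsS cw.
move=> [x _ [+ Ew]]; rewrite /cylinder /= size_rcons drawsS => /rcons_inj[cw _].
by split.
Qed.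

(** Among the [n] possible next coupons, those already in [c] leave the number of missing ones
    unchanged and the [n - #|c|] others lower it by one. *)
Lemma sum_after_draw (g : nat -> R) (c : seq 'I_n) :
  \sum_(x < n) g (n - #|rcons c x|)%N = n%:R * draw_step n g (n - #|c|)%N.
Proof.
have cn : (#|c| <= n)%N by rewrite -[leqRHS]card_ord max_card.
rewrite (bigID (mem c)) /=.
rewrite (eq_bigr (fun=> g (n - #|c|)%N)); last by move=> x xc; rewrite card_rcons xc.
rewrite [X in _ + X](eq_bigr (fun=> g (n - #|c|).-1%N)); last first.
  by move=> x xc; rewrite card_rcons xc add1n subnS.
rewrite !sumr_const.
have -> : #|[pred x | x \notin c]| = (n - #|c|)%N.
  have /(congr1 (fun k => (k - #|c|)%N)) := cardC (mem c).
  by rewrite addKn card_ord => <-; exact: eq_card.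
have n0' : n%:R != 0 :> R by rewrite pnatr_eq0 -lt0n.
rewrite -[X in X + _]mulr_natr -[X in _ + X]mulr_natr /draw_step natrB//.
by field.
Qed.

(** Induction on the remaining draws, for every prefix [c]: the next coupon splits the event into
    [n] disjoint ones of the same form. Measurability is carried along since additivity requires it.
    The empty prefix gives the law of the waiting time. *)
Lemma cylinder_reached t c :
  measurable (cylinder c `&` reached (size c + t)) /\
  P (cylinder c `&` reached (size c + t)) =
  ((n%:R^-1) ^+ size c * iter t (draw_step n) (at_most R m) (n - #|c|)%N)%:E.
Proof.
elim: t c => [|t IH] c.
  rewrite addn0 /=.
  have cn : (#|c| <= n)%N by rewrite -[leqRHS]card_ord max_card.
  rewrite /at_most leq_subCl.
  have [h|h] := boolP (n - m <= #|c|)%N.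
    have -> : cylinder c `&` reached (size c) = cylinder c.
      apply/seteqP; split => [w []//|w cw]; split => //.
      by rewrite /reached /= cw.
    by rewrite mulr1 cylinder_prob; split => //; exact: cylinder_measurable.
  have -> : cylinder c `&` reached (size c) = set0.
    apply/seteqP; split => // w [cw]; rewrite /reached /= cw.
    by rewrite (negbTE h).
  by rewrite measure0 mulr0; split.
have mE x : measurable (cylinder (rcons c x) `&` reached (size c + t.+1)).
  by have [] := IH (rcons c x); rewrite size_rcons addSnnS.
rewrite cylinder_split; split; first exact: bigsetU_measurable.
rewrite measure_bigsetU_ord//; last first.
  apply/trivIsetP => x y _ _ xy; apply/seteqP; split => // w [[+ _] [+ _]].
  rewrite /cylinder /= !size_rcons !drawsS => /rcons_inj[_ Xx] /rcons_inj[_ Xy].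
  by move: xy; rewrite -Xx -Xy eqxx.
rewrite (eq_bigr (fun x : 'I_n => ((n%:R^-1) ^+ (size c).+1 *
    iter t (draw_step n) (at_most R m) (n - #|rcons c x|)%N)%:E)); last first.
  by move=> x _; have [_] := IH (rcons c x); rewrite size_rcons addSnnS.
rewrite sumEFin -mulr_sumr sum_after_draw iterS; congr EFin.
by rewrite exprSr mulrA mulfVK// pnatr_eq0 -lt0n.
Qed.

Theorem waiting_time_cdf (S x : R) :
  fine (P [set w | ((n%:R^-1)%:E * waiting_time R X m w - S%:E <= x%:E)%E])
  = coupon_cdf n m (x + S).
Proof.
rewrite /coupon_cdf; case: ltP => y0.
  rewrite (_ : [set w | _] = set0) ?measure0//.
  apply/seteqP; split => // w /= /waiting_time_le_distinct[].
  by rewrite leNgt y0.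
set t := Num.truncn _.
have [_ /(congr1 fine)] := cylinder_reached t [::].
rewrite /= expr0 mul1r add0n card0 subn0 => <-.
congr (fine (P _)); apply/seteqP; split => w /=.
  move=> /waiting_time_le_distinct[_]; rewrite -/t distinct_couponsE.
  by move=> h; split.
move=> [_ h]; apply/waiting_time_le_distinct; split => //.
by rewrite -/t distinct_couponsE.
Qed.

End WaitingTime.

(** * Convolution with exponential densities *)

Section ExponentialConvolution.
Context (R : realType).
Notation mu := (@lebesgue_measure R).
Implicit Types (x y u : R).

Lemma ge0_continuous_FTC2Ny (f F : R -> R) (a : R) :
  (forall x, 0 <= f x) -> continuous f ->
  (forall x, is_derive x 1 F (f x)) -> F (- x) @[x --> +oo] --> 0 ->
  (\int[mu]_(x in `]-oo, a]) (f x)%:E = (F a)%:E)%E.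
Proof.
move=> f0 cf dF F0; rewrite -[a]opprK ge0_integration_by_substitutionNy; last 2 first.
- exact: continuous_subspaceT.
- by move=> x _; exact: f0.
have cFN : continuous (fun x => - F (- x)).
  move=> x; apply: cvgN; apply: continuous_comp; first exact: opp_continuous.
  by apply/differentiable_continuous/derivable1_diffP; have [] := dF (- x).
have dFN x : is_derive x 1 (fun x => - F (- x)) (f (- x)).
  have := is_deriveN (@is_derive1_comp R F -%R x _ _ (dF (- x)) (is_deriveN (is_derive_id x 1))).
  by rewrite mulrN1 opprK; exact.
rewrite (@ge0_continuous_FTC2y R _ (fun x => - F (- x)) (- a) 0)//.
- by rewrite opprK sub0e EFinN oppeK.
- by move=> x _; exact: f0.
- by apply: continuous_subspaceT => x; apply: continuous_comp; [exact: opp_continuous|exact: cf].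
- by rewrite -oppr0; exact: cvgN.
- by apply: cvg_at_right_filter; exact: cFN.
- by move=> x _; rewrite derive1E; have [_ ->] := dFN x.
Qed.

Lemma expR_decay_cvg (F : R -> R) (K : R) :
  (forall x, `|F x| <= K * expR (2 * x)) -> F (- x) @[x --> +oo] --> 0.
Proof.
move=> FK; apply/norm_cvg0P.
apply: (@squeeze_cvgr _ _ _ _ (fun=> 0) (fun x => K * (expR (- x) * expR (- x)))).
- apply: nearW => x; rewrite normr_ge0 /= (le_trans (FK (- x)))//.
  by rewrite expRM_natl expr2.
- exact: cvg_cst.
- rewrite -[X in _ --> X](mulr0 K); apply: cvgMr.
  by rewrite -[X in _ --> X](mulr0 0); apply: cvgM; exact: cvgr_expR.
Qed.

Lemma continuous_measurable_EFin (f : R -> R) (D : set R) :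
  continuous f -> measurable_fun D (EFin \o f).
Proof.
move=> cf; apply/measurable_EFinP; apply: measurable_funTS.
exact: continuous_measurable_fun.
Qed.

(* Agrees with [hk] on [0, +oo[ when [r] is a positive integer. *)
Definition expdens (r y : R) : R := r * expR (- (r * y)).

Lemma expdens_ge0 r y : 0 <= r -> 0 <= expdens r y.
Proof. by move=> r0; rewrite mulr_ge0// expR_ge0. Qed.

Lemma continuous_expdens r : continuous (expdens r).
Proof.
move=> y; apply: cvgMr; apply: continuous_comp; last exact: continuous_expR.
by apply: cvgN; apply: cvgMr; exact: cvg_id.
Qed.

Lemma integral_expdens r : 0 < r ->
  (\int[mu]_(y in `[0%R, +oo[) (expdens r y)%:E = 1)%E.
Proof.
move=> r0; rewrite -(integral_exponential_pdf r0) integral_mkcond.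
apply: eq_integral => y _; rewrite restrict_EFin; congr EFin.
by rewrite /exponential_pdf !patchE /expdens mulNr.
Qed.

Lemma integrable_expdens r : 0 < r ->
  mu.-integrable `[0%R, +oo[ (EFin \o expdens r).
Proof.
move=> r0; apply/integrableP; split.
  by apply: continuous_measurable_EFin; exact: continuous_expdens.
under eq_integral do rewrite /= ger0_norm ?expdens_ge0 ?ltW//.
by rewrite integral_expdens// ltry.
Qed.

(** Half of the exponential absorbs the factor [y]; the other half is a density of rate [r / 2], so
    the mean is at most [4 / r] without being computed. *)
Lemma moment_expdens r y : 0 < r -> 0 <= y ->
  y * expdens r y <= 4 / r * expdens (r / 2) y.
Proof.
move=> r0 y0; rewrite /expdens.
have E : expR (- (r * y)) = expR (- (r / 2 * y)) * expR (- (r / 2 * y)).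
  by rewrite -expRD; congr expR; field.
have h : r / 2 * y * expR (- (r / 2 * y)) <= 1.
  rewrite mulrC -[X in _ * X]expr1; apply: (@expRN_exp_le R _ 1).
  by rewrite mulr_ge0// ltW// divr_gt0.
have := ler_wpM2r (expR_ge0 (- (r / 2 * y))) h.
rewrite E; have -> : 4 / r * (r / 2 * expR (- (r / 2 * y))) = 2 * expR (- (r / 2 * y)).
  by field; rewrite lt0r_neq0.
lra.
Qed.

Lemma measurable_itv0y : measurable (`[0%R, +oo[%classic : set R).
Proof. exact: measurable_itv. Qed.

Section Convolution.
Context (r : R) (r0 : 0 < r).

Definition expconv (g : R -> R) (u : R) : R :=
  \int[mu]_(y in `[0, +oo[) (g (u - y) * expdens r y).

Lemma integrable_expconv (g : R -> R) (M : R) u : continuous g ->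
  (forall x, `|g x| <= M) ->
  mu.-integrable `[0%R, +oo[ (EFin \o (fun y => g (u - y) * expdens r y)).
Proof.
move=> cg gM.
apply: (@le_integrable _ _ _ mu _ measurable_itv0y _ (fun y => M%:E * (expdens r y)%:E)%E).
- apply: continuous_measurable_EFin => y.
  apply: cvgM; last exact: continuous_expdens.
  by apply: continuous_comp; [apply: cvgB; [exact: cvg_cst|exact: cvg_id]|exact: cg].
- move=> y _; rewrite /= lee_fin !normrM ler_wpM2r//.
  by apply: le_trans (gM _) _; exact: ler_norm.
- by apply: integrableZl => //; exact: integrable_expdens.
Qed.

Section Tonelli.
Context (g G : R -> R) (M x : R).
Context (g0 : forall x, 0 <= g x) (gM : forall x, g x <= M) (cg : continuous g).
Context (dG : forall x, is_derive x 1 G (g x)).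
Context (K : R) (GK : forall x, `|G x| <= K * expR (2 * x)).

Let gM' y : `|g y| <= M. Proof. by rewrite ger0_norm. Qed.

Let psi (z : R * R) : R := g (z.1 - z.2) * expdens r z.2.
Let D1 : set R := `]-oo, x]%classic.
Let D2 : set R := `[0%R, +oo[%classic.
Let f : R * R -> \bar R := (EFin \o psi) \_ (D1 `*` D2).

Let mD1 : measurable D1. Proof. exact: measurable_itv. Qed.
Let mD2 : measurable D2. Proof. exact: measurable_itv. Qed.

Let mf : measurable_fun setT f.
Proof.
apply/measurable_restrict => //; first exact: measurableX.
apply/measurable_EFinP; apply: measurable_funTS; apply: measurable_funM.
  apply: measurableT_comp; first exact: continuous_measurable_fun.
  by apply: measurable_funB; [exact: measurable_fst|exact: measurable_snd].
apply: measurableT_comp; last exact: measurable_snd.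
by apply: continuous_measurable_fun; exact: continuous_expdens.
Qed.

Let psi0 z : 0 <= psi z.
Proof. by rewrite mulr_ge0// expdens_ge0// ltW. Qed.

Let f0 z : (0 <= f z)%E.
Proof. by rewrite /f patchE; case: ifP => // _; rewrite lee_fin. Qed.

Let inner_y u : (\int[mu]_y f (u, y) =
  ((fun u => (expconv g u)%:E) \_ D1) u)%E.
Proof.
rewrite patchE; have [uD|uD] := boolP (u \in D1).
  rewrite /expconv /Rintegral fineK; last first.
    by apply: integrable_fin_num => //; exact: (integrable_expconv u cg gM').
  rewrite [RHS]integral_mkcond; apply: eq_integral => y _.
  rewrite /f !patchE; congr (if _ then _ else _).
  by rewrite in_setX uD.
rewrite integral0_eq// => y _; rewrite /f patchE in_setX.
by rewrite (negbTE uD).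
Qed.

Let inner_u y : (\int[mu]_u f (u, y) =
  ((fun y => (expdens r y * G (x - y))%:E) \_ D2) y)%E.
Proof.
rewrite patchE; have [yD|yD] := boolP (y \in D2); last first.
  rewrite integral0_eq// => u _; rewrite /f patchE in_setX.
  by rewrite (negbTE yD) andbF.
have cgy : continuous (fun u => g (u - y)).
  by move=> u; apply: continuous_comp; [apply: cvgB; [exact: cvg_id|exact: cvg_cst]|exact: cg].
transitivity (\int[mu]_(u in D1) ((expdens r y)%:E * (g (u - y))%:E))%E.
  rewrite [RHS]integral_mkcond; apply: eq_integral => u _.
  rewrite /f !patchE in_setX yD andbT /psi /=.
  by rewrite -EFinM mulrC.
rewrite ge0_integralZl//; last 3 first.
- exact: (@continuous_measurable_EFin (fun u => g (u - y))).
- by move=> u _; rewrite lee_fin.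
- by rewrite lee_fin expdens_ge0// ltW.
have dGy u : is_derive u 1 (fun u => G (u - y)) (g (u - y)).
  have h : is_derive u 1 (fun u : R => u - y) (1 - 0) by exact: is_deriveB.
  by have := @is_derive1_comp R G _ u _ _ (dG (u - y)) h; rewrite subr0 mulr1; exact.
have Gy0 : (fun u => G (u - y)) (- u) @[u --> +oo] --> 0.
  apply: (@expR_decay_cvg (fun u => G (u - y)) (K * expR (2 * - y))) => u.
  by rewrite -mulrA -expRD -mulrDr addrC.
by rewrite (ge0_continuous_FTC2Ny x (fun u => g0 (u - y)) cgy dGy Gy0).
Qed.

(** Integrating the convolution up to [x] convolves the primitive [G] instead; Tonelli applies
    because [g] is nonnegative. *)
Let exchange : (\int[mu]_(u in D1) (expconv g u)%:E =
  \int[mu]_(y in D2) (expdens r y * G (x - y))%:E)%E.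
Proof.
rewrite integral_mkcond [RHS]integral_mkcond.
transitivity (\int[mu]_u \int[mu]_y f (u, y))%E.
  by apply: eq_integral => u _; rewrite inner_y.
transitivity (\int[mu]_y \int[mu]_u f (u, y))%E; first exact: fubini_tonelli.
by apply: eq_integral => y _; rewrite inner_u.
Qed.

Let G_lipschitz a b : `|G a - G b| <= M * `|a - b|.
Proof. exact: lipschitz_derive_bound dG gM'. Qed.

Let integrable_shift : mu.-integrable D2 (EFin \o (fun y => expdens r y * G (x - y))).
Proof.
have K0 : 0 <= K by have := GK 0; rewrite mulr0 expR0 mulr1; exact: le_trans.
apply: (@le_integrable _ _ _ mu _ mD2 _ (fun y => (K * expR (2 * x))%:E * (expdens r y)%:E)%E).
- apply: continuous_measurable_EFin => y; apply: cvgM; first exact: continuous_expdens.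
  apply: continuous_comp; first by apply: cvgB; [exact: cvg_cst|exact: cvg_id].
  by apply/differentiable_continuous/derivable1_diffP; have [] := dG (x - y).
- move=> y; rewrite /D2 /= in_itv /= andbT => y0; rewrite lee_fin mulrC !normrM.
  rewrite ler_wpM2r// (le_trans (GK _))// -normrM ger0_norm; last by rewrite mulr_ge0 ?expR_ge0.
  by rewrite ler_wpM2l// ler_expR; lra.
- by apply: integrableZl => //; exact: integrable_expdens.
Qed.


Lemma expconv_integrable : mu.-integrable D1 (EFin \o expconv g).
Proof.
have E0 u : 0 <= expconv g u.
  by apply: Rintegral_ge0 => y _; rewrite mulr_ge0// expdens_ge0// ltW.
apply/integrableP; split.
  rewrite -[D1]setTI; apply/(measurable_restrict _ mD1 measurableT).
  have -> : (EFin \o expconv g) \_ D1 = fubini_F mu f.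
    by apply/funext => u; rewrite /fubini_F inner_y.
  exact: measurable_fun_fubini_tonelli_F.
under eq_integral do rewrite /= ger0_norm//.
rewrite exchange -ge0_fin_numE; last first.
  rewrite -exchange; apply: integral_ge0 => u _; exact: E0.
exact: integrable_fin_num integrable_shift.
Qed.


(** The exponential density has mass 1, so the difference averages [G (x - y) - G x], which is at
    most [M y] in absolute value. *)
Lemma expconv_integral : `|\int[mu]_(u in D1) expconv g u - G x| <= 4 * M / r.
Proof.
have M0 : 0 <= M by apply: le_trans (g0 0) (gM 0).
have r20 : 0 < r / 2 by rewrite divr_gt0.
rewrite /Rintegral exchange -/(Rintegral _ _ _).
have -> : G x = \int[mu]_(y in D2) (expdens r y * G x).
  rewrite RintegralZr//; last exact: integrable_expdens.
  by rewrite /Rintegral integral_expdens//= mul1r.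
have iG : mu.-integrable D2 (EFin \o (fun y => expdens r y * G x)).
  rewrite (_ : _ \o _ = (fun y => (EFin \o expdens r) y * (G x)%:E)%E)//.
  by apply: integrableZr => //; exact: integrable_expdens.
rewrite -RintegralB//.
have iB : mu.-integrable D2 (EFin \o (fun y => expdens r y * G (x - y) - expdens r y * G x)).
  by apply: (integrableB _ integrable_shift iG).
apply: le_trans (le_normr_Rintegral _ iB) _ => //.
have iE : mu.-integrable D2 (EFin \o (fun y => 4 * M / r * expdens (r / 2) y)).
  rewrite (_ : _ \o _ = (fun y => (4 * M / r)%:E * (EFin \o expdens (r / 2)) y)%E)//.
  by apply: integrableZl => //; exact: integrable_expdens.
apply: (@le_trans _ _ (\int[mu]_(y in D2) (4 * M / r * expdens (r / 2) y))).
  apply: le_Rintegral => //; first exact: (integrable_norm iB).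
  move=> y; rewrite /D2 /= in_itv /= andbT => y0.
  rewrite -mulrBr normrM ger0_norm; last by rewrite expdens_ge0// ltW.
  have := G_lipschitz (x - y) x.
  rewrite (_ : x - y - x = - y); last by ring.
  rewrite normrN (ger0_norm y0) => h.
  apply: (le_trans (ler_wpM2l (expdens_ge0 y (ltW r0)) h)).
  have := ler_wpM2l M0 (moment_expdens r0 y0).
  have -> : M * (y * expdens r y) = expdens r y * (M * y) by ring.
  have -> : M * (4 / r * expdens (r / 2) y) = 4 * M / r * expdens (r / 2) y by ring.
  by [].
rewrite RintegralZl//; last exact: integrable_expdens.
by rewrite /Rintegral integral_expdens//= mulr1 lexx.
Qed.

End Tonelli.

End Convolution.
End ExponentialConvolution.

Section RealLinearIntegral.
Context d (T : measurableType d) (R : realType) (mu : {measure set T -> \bar R}).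
Implicit Types (a b : R).

Lemma integrable_EFin_lin (D : set T) a b (f g : T -> R) : measurable D ->
  mu.-integrable D (EFin \o f) -> mu.-integrable D (EFin \o g) ->
  mu.-integrable D (EFin \o (fun y => a * f y + b * g y)).
Proof.
move=> mD fi gi.
have := integrableD mD (integrableZl mD a fi) (integrableZl mD b gi).
by apply: eq_integrable.
Qed.

Lemma Rintegral_lin (D : set T) a b (f g : T -> R) : measurable D ->
  mu.-integrable D (EFin \o f) -> mu.-integrable D (EFin \o g) ->
  \int[mu]_(y in D) (a * f y + b * g y) =
  a * \int[mu]_(y in D) f y + b * \int[mu]_(y in D) g y.
Proof.
move=> mD fi gi; rewrite RintegralD// ?RintegralZl//.
- by have := integrableZl mD a fi; apply: eq_integrable.
- by have := integrableZl mD b gi; apply: eq_integrable.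
Qed.

End RealLinearIntegral.

(** * The integrals of the convolutions in the correction term *)

Section CorrectionIntegral.
Context (R : realType).
Notation mu := (@lebesgue_measure R).
Implicit Types (x y z u c r : R) (m j k : nat).

Definition conv_approx r x (g : R -> R) (v C : R) : Prop :=
  [/\ forall u, mu.-integrable `[0%R, +oo[ (EFin \o (fun y => g (u - y) * expdens r y)),
      mu.-integrable `]-oo, x] (EFin \o expconv r g)
    & `|\int[mu]_(u in `]-oo, x]) expconv r g u - v| <= C / r].

Lemma conv_approx_lin r x a b (g h : R -> R) v w C D :
  conv_approx r x g v C -> conv_approx r x h w D ->
  conv_approx r x (fun z => a * g z + b * h z) (a * v + b * w) (`|a| * C + `|b| * D).
Proof.
move=> [g1 g2 g3] [h1 h2 h3].
have E y u : (a * g (u - y) + b * h (u - y)) * expdens r y =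
    a * (g (u - y) * expdens r y) + b * (h (u - y) * expdens r y) by ring.
have E' : expconv r (fun z => a * g z + b * h z) =
    (fun u => a * expconv r g u + b * expconv r h u).
  apply/funext => u; rewrite /expconv -Rintegral_lin//.
  by apply: eq_Rintegral => y _; rewrite E.
split.
- move=> u; under [X in _.-integrable _ (_ \o X)]eq_fun do rewrite E.
  exact: integrable_EFin_lin.
- by rewrite E'; exact: integrable_EFin_lin.
- rewrite E' Rintegral_lin//.
  rewrite (_ : _ - _ = a * (\int[mu]_(u in `]-oo, x]) expconv r g u - v) +
    b * (\int[mu]_(u in `]-oo, x]) expconv r h u - w)); last by ring.
  apply: (le_trans (ler_normD _ _)); rewrite !normrM mulrDl -!mulrA.
  by rewrite lerD// ler_wpM2l.
Qed.

(* The primitive of [eterm z j] vanishing at [-oo], for [0 < j]. *)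
Definition eprim z j : R := (j.-1)`!%:R * cdf_deriv j.-1 0 (eterm z).

Lemma eprim_derive j z : is_derive z 1 (fun y => eprim y j.+1) (eterm z j.+1).
Proof.
have := is_deriveZ (j`!%:R : R) (cdf_deriv_eterm_derive j 0 z).
by rewrite [X in is_derive _ _ _ X](_ : _ = eterm z j.+1)// /GRing.scale/= mulVKf//
  pnatr_eq0 -lt0n fact_gt0.
Qed.

(** Integrated form of [eterm_derive]: at positive indices, one application of the recursion of
    [fam_deriv] to the primitives returns the terms themselves. *)
Lemma eprim_rec z j : eprim z j.+2 - j.+1%:R * eprim z j.+1 = eterm z j.+1.
Proof.
rewrite /eprim /= [in X in X - _]big_ord_recr /= mulrDr factS natrM addrC mulrA addKr.
by rewrite mulrC mulfVK// mulf_neq0// pnatr_eq0 -?lt0n ?fact_gt0.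
Qed.

Lemma is_derive_shift (F : R -> R) c x v :
  is_derive (x + c) 1 F v -> is_derive x 1 (fun y => F (y + c)) v.
Proof.
move=> dF; have h : is_derive x 1 (fun y : R => y + c) (1 + 0) by exact: is_deriveD.
by have := @is_derive1_comp R F _ x _ _ dF h; rewrite addr0 mulr1; exact.
Qed.

Lemma continuous_eterm j c : continuous (fun z => eterm (z + c) j).
Proof.
move=> z; apply/differentiable_continuous/derivable1_diffP.
by have [] := is_derive_shift (eterm_derive j (z + c)).
Qed.

Lemma conv_approx_eterm j c : exists2 C : R, 0 <= C & forall r x, 0 < r ->
  conv_approx r x (fun z => eterm (z + c) j.+1) (eprim (x + c) j.+1) C.
Proof.
exists (4 * (j.+1)`!%:R) => [|r x r0]; first by rewrite mulr_ge0.
have [K K0 hK] := cdf_deriv_eterm_decay R j 0.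
have d0 z := is_derive_shift (eprim_derive j (z + c)).
have ge z : 0 <= eterm (z + c) j.+1 by exact: eterm_ge0.
have le z : eterm (z + c) j.+1 <= (j.+1)`!%:R by exact: eterm_le.
have decay z : `|eprim (z + c) j.+1| <= j`!%:R * K * expR (2 * c) * expR (2 * z).
  rewrite /eprim normrM ger0_norm// -!mulrA ler_wpM2l//.
  by rewrite -expRD -mulrDr [c + z]addrC.
split.
- move=> u; apply: (integrable_expconv r0 u (@continuous_eterm _ c)).
  by move=> z; exact: eterm_bound.
- exact: (expconv_integrable r0 x ge le (@continuous_eterm _ c) d0 decay).
- exact: (expconv_integral r0 x ge le (@continuous_eterm _ c) d0 decay).
Qed.

Lemma conv_approx_fam_deriv k j c : exists2 C : R, 0 <= C & forall r x, 0 < r ->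
  conv_approx r x (fun z => fam_deriv k (eterm (z + c)) j.+1)
    (fam_deriv k (eprim (x + c)) j.+1) C.
Proof.
elim: k j => [|k IH] j; first exact: conv_approx_eterm.
have [C C0 h] := IH j.+1; have [D D0 h'] := IH j.
exists (`|1 : R| * C + `|- j.+1%:R : R| * D) => [|r x r0].
  by rewrite addr_ge0// mulr_ge0.
have := conv_approx_lin 1 (- j.+1%:R) (h r x r0) (h' r x r0).
rewrite /= mul1r mulNr; congr (conv_approx _ _ _ _ _).
by apply/funext => z; rewrite mul1r mulNr.
Qed.

Lemma conv_approx_cdf_deriv m c : exists2 C : R, 0 <= C & forall r x, 0 < r ->
  conv_approx r x (fun z => cdf_deriv m 3 (eterm (z + c))) (cdf_deriv m 2 (eterm (x + c))) C.
Proof.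
have [C C0 h] := conv_approx_fam_deriv 2 m c.
exists (`|(m`!%:R)^-1 : R| * C + `|0 : R| * C) => [|r x r0].
  by rewrite addr_ge0// mulr_ge0.
have := conv_approx_lin (m`!%:R)^-1 0 (h r x r0) (h r x r0).
rewrite mul0r addr0.
have -> : fam_deriv 2 (eprim (x + c)) m.+1 = fam_deriv 1 (eterm (x + c)) m.+1.
  rewrite /= -!eprim_rec; ring.
congr (conv_approx _ _ _ _ _).
by apply/funext => z; rewrite mul0r addr0.
Qed.

Lemma fmE m x : fm m x = cdf_deriv m 1 (eterm (x + Cm R m)).
Proof. by rewrite /fm /= /eterm -mulrA -mulrN expRM_natl. Qed.

Lemma derive_cdf_deriv_eterm m k c :
  (fun z => cdf_deriv m k (eterm (z + c)))^`()%classic = (fun z => cdf_deriv m k.+1 (eterm (z + c))).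
Proof.
apply/funext => z; rewrite derive1E.
by have [_ ->] := is_derive_shift (cdf_deriv_eterm_derive m k (z + c)).
Qed.

Lemma fm_derive2 m : derive1n 2 (@fm R m) = (fun z => cdf_deriv m 3 (eterm (z + Cm R m))).
Proof.
have -> : @fm R m = (fun z => cdf_deriv m 1 (eterm (z + Cm R m))).
  by apply/funext => z; rewrite fmE.
by rewrite derive1nS derive1n1 !derive_cdf_deriv_eterm.
Qed.

Lemma FmE m x : Fm m x = cdf_deriv m 0 (eterm (x + Cm R m)).
Proof.
have [K K0 hK] := cdf_deriv_eterm_decay R m 0.
have d0 z := is_derive_shift (eprim_derive m (z + Cm R m)).
have decay z : `|eprim (z + Cm R m) m.+1| <= m`!%:R * K * expR (2 * Cm R m) * expR (2 * z).
  rewrite /eprim normrM ger0_norm// -!mulrA ler_wpM2l//.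
  by rewrite -expRD -mulrDr [Cm R m + z]addrC.
have E := ge0_continuous_FTC2Ny x (fun z => eterm_ge0 (z + Cm R m) m.+1)
  (@continuous_eterm _ _) d0 (expR_decay_cvg decay).
rewrite /Fm /Rintegral.
under eq_integral => y _.
  rewrite -mulrN expRM_natl mulrC.
  over.
by rewrite /= E /= /eprim /= mulKf// pnatr_eq0 -lt0n fact_gt0.
Qed.

Lemma fm2_conv_hkE m k : (0 < k)%N ->
  @fm2_conv_hk R m k = expconv k%:R (fun z => cdf_deriv m 3 (eterm (z + Cm R m))).
Proof.
move=> k0; apply/funext => u; rewrite /fm2_conv_hk fm_derive2; apply: eq_Rintegral => y.
by rewrite inE/= in_itv/= andbT /hk => ->.
Qed.

Lemma fm2_conv_hk_integral m : exists2 C : R, 0 <= C & forall k x, (0 < k)%N ->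
  `|\int[mu]_(u in `]-oo, x]) fm2_conv_hk m k u - cdf_deriv m 2 (eterm (x + Cm R m))|
  <= C / k%:R.
Proof.
have [C C0 h] := conv_approx_cdf_deriv m (Cm R m); exists C => // k x k0.
by rewrite fm2_conv_hkE//; have [] := h k%:R x _; rewrite ?ltr0n.
Qed.

End CorrectionIntegral.

(** * Harmonic sums and the final estimates *)

Section Harmonic.
Context (R : realType).
Implicit Types (n m k : nat).

Definition harm n : R := \sum_(1 <= k < n.+1) k%:R^-1.

Lemma harmS n : harm n.+1 = harm n + n.+1%:R^-1.
Proof. by rewrite /harm big_nat_recr. Qed.

Lemma ln_succ_bounds n : (0 < n)%N ->
  n.+1%:R^-1 <= ln n.+1%:R - ln n%:R :> R /\
  ln n.+1%:R - ln n%:R <= n%:R^-1 :> R.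
Proof.
move=> n0; have n0' : 0 < n%:R :> R by rewrite ltr0n.
have n1' : 0 < n.+1%:R :> R by rewrite ltr0n.
split.
  rewrite -lerN2 opprB -ln_div ?posrE//.
  have -> : n%:R / n.+1%:R = 1 + - n.+1%:R^-1 :> R.
    have -> : n%:R = n.+1%:R - 1 :> R by rewrite -natr1 addrK.
    by rewrite mulrBl divff ?lt0r_neq0// mul1r.
  by apply: le_ln1Dx; rewrite ltrN2 invf_lt1// ltr1n.
rewrite -ln_div ?posrE//.
have -> : n.+1%:R / n%:R = 1 + n%:R^-1 :> R.
  by rewrite -natr1 mulrDl divff ?lt0r_neq0// mul1r.
by apply: le_ln1Dx; apply: lt_le_trans (_ : 0 <= _); rewrite ?ltrN10 ?invr_ge0.
Qed.

Lemma harm_ln_nonincreasing n k : (0 < n)%N -> (n <= k)%N ->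
  harm k - ln k%:R <= harm n - ln n%:R.
Proof.
move=> n0; elim: k => [|k IH]; first by rewrite leqn0 => /eqP nE; rewrite nE in n0.
rewrite leq_eqVlt => /predU1P[->//|nk]; apply: le_trans (IH nk).
have [+ _] := ln_succ_bounds (leq_trans n0 nk).
by rewrite harmS; move: (k.+1%:R^-1) (ln k.+1%:R) => u v; lra.
Qed.

Lemma harm_ln_nondecreasing n k : (0 < n)%N -> (n <= k)%N ->
  harm n - ln n%:R - n%:R^-1 <= harm k - ln k%:R - k%:R^-1.
Proof.
move=> n0; elim: k => [|k IH]; first by rewrite leqn0 => /eqP nE; rewrite nE in n0.
rewrite leq_eqVlt => /predU1P[->//|nk]; apply: le_trans (IH nk) _.
have [_ +] := ln_succ_bounds (leq_trans n0 nk).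
by rewrite harmS; move: (k.+1%:R^-1) (ln k.+1%:R) => u v; lra.
Qed.

Lemma harm_ln_bounds n : (0 < n)%N -> 0 <= harm n - ln n%:R <= 1.
Proof.
move=> n0.
have h1 : harm 1 = 1 by rewrite /harm big_nat1 invr1.
have := harm_ln_nonincreasing (ltn0Sn 0) n0.
have := harm_ln_nondecreasing (ltn0Sn 0) n0.
have : 0 <= n%:R^-1 :> R by rewrite invr_ge0.
rewrite h1 ln1 invr1 => *; apply/andP; split; lra.
Qed.

Lemma euler_gamma_bounds n : (0 < n)%N ->
  0 <= harm n - ln n%:R - euler_gamma R <= n%:R^-1.
Proof.
move=> n0; pose a k : R := harm k - ln k%:R.
(* The shift avoids index 0, where [ln 0 = 0] by convention and monotonicity fails. *)
have ni : nonincreasing_seq (fun k => a (k + n)%N).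
  by apply/nonincreasing_seqP => k; apply: harm_ln_nonincreasing; rewrite ?leq_addl// addn_gt0 n0 orbT.
have lb : has_lbound (range (fun k => a (k + n)%N)).
  exists 0 => _ [k _ <-]; have kn : (0 < k + n)%N by rewrite addn_gt0 n0 orbT.
  by have /andP[] := harm_ln_bounds kn.
have cv := nonincreasing_is_cvgn ni lb.
have E : euler_gamma R = limn (fun k => a (k + n)%N).
  apply: cvg_lim; first exact: Rhausdorff.
  by rewrite -(cvg_shiftn n); exact: cv.
have h1 := nonincreasing_cvgn_ge ni cv 0%N.
have h2 : a n - n%:R^-1 <= limn (fun k => a (k + n)%N).
  apply: limr_ge => //; apply: nearW => k.
  have := harm_ln_nondecreasing n0 (leq_addl k n).
  have : 0 <= (k + n)%:R^-1 :> R by rewrite invr_ge0.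
  by rewrite /a; lra.
rewrite E; move: h1 h2; rewrite add0n /a => *; apply/andP; split; lra.
Qed.

Lemma harm_full m n : (m <= n)%N ->
  \sum_(m.+1 <= k < n.+1) k%:R^-1 = harm n - harm m.
Proof.
by move=> mn; rewrite /harm [in RHS](big_cat_nat (n := m.+1))//= [RHS]addrC addKr.
Qed.

Lemma harm_partial m n : (m < n)%N ->
  \sum_(m.+1 <= k < n) k%:R^-1 = harm n - n%:R^-1 - harm m.
Proof.
move=> mn; case: n mn => // n; rewrite ltnS => mn.
by rewrite harmS addrK harm_full.
Qed.

Lemma sum_inv_squares m n : \sum_(m.+1 <= k < n) k%:R^-1 ^+ 2 <= 2 :> R.
Proof.
case: n => [|n]; first by rewrite big_geq.
(* Strengthened so that the induction closes, by [1/(n+1)^2 <= 1/n - 1/(n+1)]. *)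
suff : (0 < n)%N -> \sum_(m.+1 <= k < n.+1) k%:R^-1 ^+ 2 <= 2 - n%:R^-1 :> R.
  case: n => [|n h]; first by rewrite big_geq.
  by apply: (le_trans (h _)) => //; rewrite gerBl invr_ge0.
elim: n => // n IH _; have [mn|nm] := leqP m n; last first.
  rewrite big_geq// subr_ge0.
  by apply: (@le_trans _ _ 1); rewrite ?ler1n// invf_le1// ler1n.
rewrite big_nat_recr//=; case: n IH mn => [|n] IH mn.
  by rewrite big_geq// invr1 expr1n; lra.
have n0 : 0 < n.+1%:R :> R by rewrite ltr0n.
apply: (le_trans (lerD (IH _) (lexx _))) => //.
have h : n.+2%:R^-1 <= n.+1%:R^-1 :> R by rewrite lef_pV2 ?posrE// ler_nat.
rewrite -lerBrDl -subr_ge0.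
have -> : 2 - n.+2%:R^-1 - (2 - n.+1%:R^-1) - n.+2%:R^-1 ^+ 2 =
    n.+2%:R^-1 * (n.+1%:R^-1 - n.+2%:R^-1) :> R.
  have -> : n.+2%:R = n.+1%:R + 1 :> R by rewrite natr1.
  have : n.+1%:R + 1 != 0 :> R by rewrite natr1 pnatr_eq0.
  move: (n.+1%:R) n0 => a a0 b0; field.
  by rewrite b0 lt0r_neq0.
by rewrite mulr_ge0 ?invr_ge0 ?subr_ge0.
Qed.

End Harmonic.

(** * Size of the corrections and the final approximations *)

Section Assembly.
Context (R : realType) (m : nat).
Implicit Types (n : nat) (x c : R) (G : nat -> R -> R).

Let H2 (z : R) := cdf_deriv m 2 (eterm z).

(** The shift [c] is [C_m] for centring by harmonic sums and 0 for centring by [log n]; both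
    two-sided bounds follow from this property alone. *)
Definition log_profile G c : Prop := exists2 C : R, 0 <= C & forall n x,
  (m.+2 <= n)%N -> `|G n x + ln n%:R / (2 * n%:R) * H2 (x + c)| <= C / n%:R.

(** Replacing each integral by [H2] costs a sum of [C / k^2], and replacing the partial harmonic sum
    by [log n] costs a bounded amount; the prefactor [1 / (2 n)] makes both [O (1 / n)]. *)
Lemma Gnm_profile : log_profile (fun n => @Gnm R n m) (Cm R m).
Proof.
have [C C0 h] := fm2_conv_hk_integral R m.
have [B B0 hB] := cdf_deriv_eterm_bound R m 2.
exists (C + B * (2 + harm R m)) => [|n x mn].
  rewrite addr_ge0// mulr_ge0// addr_ge0//.
  by apply: sumr_ge0 => k _; rewrite invr_ge0.
have n0 : (0 < n)%N by exact: leq_trans mn.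
have n0' : 0 < n%:R :> R by rewrite ltr0n.
rewrite /Gnm; set z := x + _.
pose I k : R := \int[lebesgue_measure]_(u in `]-oo, x]) fm2_conv_hk m k u.
pose S : R := \sum_(m.+1 <= k < n) k%:R^-1.
have S1 : `|\sum_(m.+1 <= k < n) (k%:R^-1 * (I k - H2 z))| <= C * 2.
  apply: (@le_trans _ _ (\sum_(m.+1 <= k < n) C * k%:R^-1 ^+ 2)).
    apply: (le_trans (ler_norm_sum _ _ _)).
    rewrite big_nat [leRHS]big_nat; apply: ler_sum => k /andP[mk _].
    have k0 : (0 < k)%N by exact: leq_ltn_trans mk.
    rewrite normrM ger0_norm ?invr_ge0// expr2 mulrCA.
    by rewrite ler_wpM2l ?invr_ge0//; exact: h.
  by rewrite -mulr_sumr ler_wpM2l// sum_inv_squares.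
have S2 : `|S - ln n%:R| <= 2 + harm R m.
  rewrite /S harm_partial; last exact: ltnW.
  have /andP[a0 a1] := harm_ln_bounds R n0.
  have hm : 0 <= harm R m by apply: sumr_ge0 => k _; rewrite invr_ge0.
  have i0 : 0 <= n%:R^-1 :> R by rewrite invr_ge0.
  have i1 : n%:R^-1 <= 1 :> R by rewrite invf_le1// ler1n.
  by rewrite ler_norml; apply/andP; split; lra.
have -> : \sum_(m.+1 <= k < n) (k%:R^-1 * I k) =
    \sum_(m.+1 <= k < n) (k%:R^-1 * (I k - H2 z)) + S * H2 z.
  by rewrite /S mulr_suml -big_split; apply: eq_bigr => k _ /=; ring.
set T := \sum_(_ <= k < _) _ in S1 *.
have -> : - (2 * n%:R)^-1 * (T + S * H2 z) + ln n%:R / (2 * n%:R) * H2 z =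
  (- (T + (S - ln n%:R) * H2 z) / 2) / n%:R.
  by field; rewrite lt0r_neq0.
rewrite normrM [X in _ * X]ger0_norm ?invr_ge0// ler_wpM2r ?invr_ge0//.
rewrite normrM normrN [X in _ * X]ger0_norm// ler_pdivrMr//.
apply: (le_trans (ler_normD _ _)); rewrite [leRHS]mulrDl lerD// normrM.
have : `|S - ln n%:R| * `|H2 z| <= (2 + harm R m) * B by apply: ler_pM => //; exact: hB.
have : 0 <= (2 + harm R m) * B by rewrite mulr_ge0// (le_trans _ S2).
lra.
Qed.

Lemma gamma_shift n : (0 < n)%N ->
  `|harm R n - ln n%:R - euler_gamma R| <= n%:R^-1.
Proof.
by move=> n0; have /andP[a0 a1] := euler_gamma_bounds R n0; rewrite ger0_norm.
Qed.

Lemma Gnm_star_profile : log_profile (fun n => @Gnm_star R n m) 0.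
Proof.
have [C C0 h] := Gnm_profile; have [D D0 k] := cdf_deriv_eterm_lipschitz R m 2.
exists (C + D) => [|n x mn]; first exact: addr_ge0.
have n0 : (0 < n)%N by exact: leq_trans mn.
have /andP[l0 l1] := log_ratio_bounds R n0.
rewrite addr0 /Gnm_star; set x' := x - _ + _.
have := h n x' mn; set g := Gnm _ _ _; set l := ln _ / _ in l0 l1 *.
have kx := k x (x' + Cm R m); rewrite -!/(H2 _) in kx => hx.
have dx : `|x - (x' + Cm R m)| <= n%:R^-1.
  have -> : x - (x' + Cm R m) = harm R n - ln n%:R - euler_gamma R.
    by rewrite /x' /Cm /harm; ring.
  exact: gamma_shift.
have -> : g + l * H2 x = g + l * H2 (x' + Cm R m) + l * (H2 x - H2 (x' + Cm R m)) by ring.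
apply: (le_trans (ler_normD _ _)); rewrite [leRHS]mulrDl lerD// normrM (ger0_norm l0).
apply: (@le_trans _ _ `|H2 x - H2 (x' + Cm R m)|); first by rewrite ler_piMl.
by apply: (le_trans kx); rewrite ler_wpM2l.
Qed.

Lemma sup_norm_le (f : R -> R) (M : R) :
  (forall x, `|f x| <= M) -> (sup_norm f <= M%:E)%E.
Proof.
by move=> h; apply: ge_ereal_sup => _ [x _ <-]; rewrite lee_fin.
Qed.

Lemma H2E z : H2 z = (m`!%:R)^-1 * (eterm z m.+1 * (expR (- z) - m.+1%:R)).
Proof. by rewrite /H2 /= [eterm z m.+2]etermS; congr (_ * _); ring. Qed.

Lemma log_profile_correction G c : log_profile G c -> log_order_correction m G.
Proof.
move=> [C C0 h]; have [B B0 hB] := cdf_deriv_eterm_bound R m 2.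
have ln2 : 0 < ln 2 :> R by rewrite ln_gt0// ltr1n.
pose xm : R := - ln m.+1%:R - c.
have H2p x : x < xm -> 0 < H2 (x + c).
  move=> xx; rewrite H2E !mulr_gt0 ?invr_gt0 ?ltr0n ?fact_gt0 ?expR_gt0//.
    by rewrite exprn_gt0// expR_gt0.
  rewrite subr_gt0 -[ltLHS](@lnK R) ?posrE ?ltr0n// ltr_expR.
  by move: xx; rewrite /xm; lra.
(* [C / ln 2] absorbs [C / n] because [n >= 2], and the 1 ensures positivity. The threshold forces
   [4 C <= H2 (x + c) log n], so the error takes at most a quarter of [H2 (x + c) log n / n] from
   the main half. The value 1 only keeps the function positive to the right of [xm]. *)
exists (C / ln 2 + B + 1), xm, (fun x => if x < xm then H2 (x + c) / 4 else 1),
  (fun x => maxn m.+2 (Num.truncn (expR (4 * C / H2 (x + c)))).+1); split.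
- by rewrite ltr_wpDl// addr_ge0// divr_ge0// ltW.
- by move=> x; case: ifP => // /H2p p; rewrite divr_gt0.
- move=> n mn; apply: sup_norm_le => x.
  have n0 : (0 < n)%N by exact: leq_trans mn.
  have n0' : 0 < n%:R :> R by rewrite ltr0n.
  have lnn : ln 2 <= ln n%:R :> R.
    by rewrite ler_ln ?posrE// ler_nat (leq_trans _ mn).
  have hx := h n x mn; have bx := hB (x + c); rewrite -/(H2 _) in bx.
  have /andP[l0 l1] := log_ratio_bounds R n0.
  set l := ln _ / (2 * _) in l0 l1 hx.
  have -> : G n x = (G n x + l * H2 (x + c)) - l * H2 (x + c) by ring.
  apply: (le_trans (ler_normB _ _)); rewrite normrM (ger0_norm l0).
  have e : ln n%:R / n%:R = 2 * l by rewrite /l; field; rewrite lt0r_neq0.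
  have t1 : C / n%:R <= C / ln 2 * (2 * l).
    rewrite -e -mulrA ler_wpM2l// mulrCA mulrA ler_pMl ?invr_gt0//.
    by rewrite ler_pdivlMr// mul1r.
  have := ler_wpM2l l0 bx; rewrite e.
  have := mulr_ge0 B0 l0; lra.
- move=> x xx n; rewrite geq_max => /andP[mn Nn]; rewrite xx.
  have n0 : (0 < n)%N by exact: leq_trans mn.
  have n0' : 0 < n%:R :> R by rewrite ltr0n.
  have hx := h n x mn; have p := H2p x xx.
  have lnn : 4 * C / H2 (x + c) <= ln n%:R.
    rewrite -[leLHS]expRK ler_ln ?posrE ?expR_gt0//.
    apply: (@le_trans _ _ (Num.truncn (expR (4 * C / H2 (x + c)))).+1%:R).
      by apply: ltW; apply: truncnS_gt.
    by rewrite ler_nat.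
  rewrite ler_pdivrMr// in lnn.
  have e : ln n%:R / (2 * n%:R) * H2 (x + c) = ln n%:R * H2 (x + c) / n%:R / 2.
    by field; rewrite lt0r_neq0.
  rewrite e in hx.
  have i0 : 0 <= n%:R^-1 :> R by rewrite invr_ge0.
  have := ler_wpM2r i0 lnn.
  have -> : H2 (x + c) / 4 * (ln n%:R / n%:R) = ln n%:R * H2 (x + c) / n%:R / 4.
    by field; rewrite lt0r_neq0.
  have -> : 4 * C * n%:R^-1 = 4 * (C / n%:R) by ring.
  move: hx; rewrite ler_norml => /andP[_ hx].
  have := ler_norm (- G n x); rewrite normrN; lra.
Qed.

Definition cdf_approximation (F : forall n d (T : measurableType d)
    (P : probability T R), (nat -> T -> 'I_n) -> R -> R) (A : nat -> R -> R) :=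
  exists (C : R) (N : nat), forall n : nat, (N <= n)%N ->
    forall (d : measure_display) (T : measurableType d)
      (P : probability T R) (X : nat -> T -> 'I_n), coupon_draws P X ->
    (sup_norm (fun x : R => F n d T P X x - A n x)%R <= (C / n%:R)%:E)%E.

(** The centred argument [y - log n] differs from [x + C_m] by [harm n - log n - gamma], at most
    [1/n], and [second_order] is Lipschitz uniformly in [n]. *)
Lemma Fnm_approximation :
  cdf_approximation (fun n d T P X => Fnm P X m) (fun n x => Fm m x + Gnm n m x).
Proof.
have [C1 C10 h1] := coupon_cdf_second_order R m.
have [C2 C20 h2] := second_order_lipschitz R m.
have [C3 C30 h3] := Gnm_profile.
exists (C1 + C2 + C3), m.+2 => n mn d T P X hX; apply: sup_norm_le => x.
have n0 : (0 < n)%N by exact: leq_trans mn.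
rewrite /Fnm (waiting_time_cdf m hX n0) harm_full; last by do 2 apply: ltnW.
set y := x + _; have H1 := h1 n y n0; have H3 := h3 n x mn.
have := h2 n (y - ln n%:R) (x + Cm R m) n0.
have -> : y - ln n%:R - (x + Cm R m) = harm R n - ln n%:R - euler_gamma R.
  by rewrite /y /Cm /harm; ring.
have := ler_wpM2l C20 (gamma_shift n0).
have -> : second_order n m (x + Cm R m) = Fm m x - ln n%:R / (2 * n%:R) * H2 (x + Cm R m).
  by rewrite FmE.
move: H1 H3; set F := coupon_cdf _ _ _; set S := second_order _ _ _.
set l := ln _ / _ * _; set g := Gnm _ _ _; move=> H1 H3 H4 H5.
have -> : F - (Fm m x + g) = (F - S) + (S - (Fm m x - l)) - (g + l) by ring.
apply: (le_trans (ler_normB _ _)); rewrite [leRHS]mulrDl lerD//.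
by apply: (le_trans (ler_normD _ _)); rewrite [leRHS]mulrDl lerD// (le_trans H5).
Qed.

Lemma Fnm_star_approximation :
  cdf_approximation (fun n d T P X => Fnm_star P X m)
    (fun n x => Fm_star m x + Gnm_star n m x).
Proof.
have [C1 C10 h1] := coupon_cdf_second_order R m.
have [C3 C30 h3] := Gnm_star_profile.
exists (C1 + C3), m.+2 => n mn d T P X hX; apply: sup_norm_le => x.
have n0 : (0 < n)%N by exact: leq_trans mn.
rewrite /Fnm_star (waiting_time_cdf m hX n0).
have := h1 n (x + ln n%:R) n0; have := h3 n x mn; rewrite addrK addr0.
rewrite /second_order /Fm_star FmE subrK -/(H2 _).
set F := coupon_cdf _ _ _; set l := ln _ / _ * _; set g := Gnm_star _ _ _.
set p := cdf_deriv _ _ _ => H3 H1.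
have -> : F - (p + g) = (F - (p - l)) - (g + l) by ring.
by apply: (le_trans (ler_normB _ _)); rewrite [leRHS]mulrDl lerD.
Qed.

End Assembly.

Theorem theorem3p1p1 (R : realType) (m : nat) :
  [/\ exists (C : R) (N : nat), forall n : nat, (N <= n)%N ->
        forall (d : measure_display) (T : measurableType d)
          (P : probability T R) (X : nat -> T -> 'I_n), coupon_draws P X ->
        (sup_norm (fun x : R => Fnm P X m x - (Fm m x + Gnm n m x))%R
           <= (C / n%:R)%:E)%E,
      log_order_correction m (fun (n : nat) (x : R) => Gnm n m x),
      exists (C : R) (N : nat), forall n : nat, (N <= n)%N ->
        forall (d : measure_display) (T : measurableType d)
          (P : probability T R) (X : nat -> T -> 'I_n), coupon_draws P X ->
        (sup_norm (fun x : R =>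
             Fnm_star P X m x - (Fm_star m x + Gnm_star n m x))%R
           <= (C / n%:R)%:E)%E
    & log_order_correction m (fun (n : nat) (x : R) => Gnm_star n m x)].
Proof.
split.
- exact: Fnm_approximation.
- exact: log_profile_correction (Gnm_profile R m).
- exact: Fnm_star_approximation.
- exact: log_profile_correction (Gnm_star_profile R m).
Qed.
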